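(* Let $a\ge2$ be an integer, $R=\mathbb{Z}/a\mathbb{Z}$ and $0<\epsilon<1$. For each $n$ let $\alpha_n,\beta_n$ be integers with $1\le\alpha_n,\beta_n\le n$, and let $M$ be a random $n\times n$ matrix over $R$ with $M_{i,j}=0$ for all $1\le i\le\alpha_n$, $1\le j\le\beta_n$, and whose other entries are independent $\epsilon$-balanced random variables in $R$. Suppose $\lim_{n\to\infty}(n-\alpha_n-\beta_n)=\infty$. Then for every finite abelian group $G$ whose exponent divides $a$, $$\lim_{n\to\infty}\mathbb{E}(\#\mathrm{Sur}(\mathrm{cok}(M),G))=\lim_{n\to\infty}\sum_{F\in\mathrm{Sur}(R^n,G)}\mathbb{P}(FM=0)=1.$$
   Context: A random variable $\xi$ in $R=\mathbb{Z}/a\mathbb{Z}$ is $\epsilon$-balanced if for every maximal ideal $\mathcal{P}$ of $R$ and every $r\in R/\mathcal{P}$, $\mathbb{P}(\xi\equiv r\pmod{\mathcal{P}})\le1-\epsilon$. $\mathrm{Sur}(A,B)$ is the set of surjective homomorphisms $A\to B$; for $F\in\mathrm{Sur}(R^n,G)$, $FM=0$ means the composition $F\circ M:R^n\to G$ is zero, where $M$ is viewed as a map $R^n\to R^n$. *)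

(* Defs.v *)
From HB Require Import structures.
From mathcomp Require Import all_boot all_order all_algebra.
From mathcomp Require Import all_fingroup all_solvable.
From mathcomp Require Import all_classical all_reals all_analysis.

Set Implicit Arguments.
Unset Strict Implicit.
Unset Printing Implicit Defensive.

Import Order.TTheory GRing.Theory Num.Theory.
Import numFieldNormedType.Exports.

Local Open Scope classical_set_scope.
Local Open Scope ring_scope.
Local Open Scope ereal_scope.

(* [Sur A B] is stated for finGroupTypes; a finZmodType is one through its
   addition, so the same definition serves R^n, cok(M) and G. *)
Definition Sur (A B : finGroupType) : {set {ffun A -> B}} :=
  [set f : {ffun A -> B} |
    morphic [set: A] f && (f @: [set: A] == [set: B])%SET]%SET.

Definition colspan (a n : nat) (M : 'M['Z_a]_n) : {set 'cV['Z_a]_n} :=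
  [set (M *m x)%R | x : 'cV['Z_a]_n]%SET.

Lemma colspan_group_set (a n : nat) (M : 'M['Z_a]_n) : group_set (colspan M).
Proof.
apply/group_setP; split.
  by apply/imsetP; exists 0%R => //; rewrite mulmx0.
move=> _ _ /imsetP[x _ ->] /imsetP[y _ ->].
by apply/imsetP; exists (x + y)%R => //; rewrite mulmxDr.
Qed.

Canonical colspan_group (a n : nat) (M : 'M['Z_a]_n) :=
  Group (colspan_group_set M).

(* The ambient group is abelian, so [coset_of] is the full quotient
   (Z/a)^n / M (Z/a)^n. *)
Definition cok (a n : nat) (M : 'M['Z_a]_n) : finGroupType :=
  coset_of (colspan M).

(* [idealr_closed] already requires the ideal to be proper. *)
Definition maximal_ideal (A : finComNzRingType) (I : {set A}) : Prop :=
  idealr_closed I /\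
  forall J : {set A}, idealr_closed J -> I \subset J -> J = I.

Section FiniteRandomVariables.
Context (d : measure_display) (Omega : measurableType d) (R : realType).
Variable P : probability Omega R.

Definition fin_random_variable (T : finType) (X : Omega -> T) : Prop :=
  forall t : T, measurable [set w | X w = t].

(* A class of A / I is given by a representative r. *)
Definition balanced (A : finComNzRingType) (eps : R) (X : Omega -> A) : Prop :=
  forall I : {set A}, maximal_ideal I ->
  forall r : A, P [set w | (X w - r)%R \in I] <= (1 - eps)%:E.

(* Mutual independence of the subfamily of X indexed by D. *)
Definition independent_on (Ix T : finType) (D : {set Ix})
    (X : Ix -> Omega -> T) : Prop :=
  forall (J : {set Ix}) (B : Ix -> {set T}), J \subset D ->
  P [set w | forall i, i \in J -> X i w \in B i] =
  \prod_(i in J) P [set w | X i w \in B i].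

End FiniteRandomVariables.

(* 0-based positions outside the top-left alpha x beta block. *)
Definition free_entries (n alpha beta : nat) : {set 'I_n * 'I_n} :=
  [set ij : 'I_n * 'I_n | ~~ ((ij.1 < alpha)%N && (ij.2 < beta)%N)]%SET.

(* Main.v *)
(* By independence and Fourier inversion on G, P(FM = 0) is |G|^-n times the
   product over the columns j of the sum over the characters C of G of
   prod_i E[zeta^(C(f_i) M_ij)], where f_i is the image under F of the i-th basis
   vector.  A balanced entry contributes at most some rho < 1 whenever
   C(f_i) <> 0, so |G|^n P(FM = 0) - 1 is at most
   S(f)^(n - beta) S'(f)^beta - 1, where S(f) is the sum over C of
   rho^#{i : C(f_i) <> 0}, and S' only counts the rows i >= alpha.  It remains
   to show that the average of S^(n - beta) S'^beta over generating tuples f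
   tends to at most 1.

   For this the group of characters is shrunk to 0 through steps
   Kx = {C in K : C(x) = 0} of prime index p, averaging f over its shifts by
   multiples of x.  At each step the ratio S_K / S_Kx is
   - close to 1 when every C in K outside Kx has many rows with C(f_i) <> 0;
   - at most p kappa with a fixed kappa < 1 when every such C has one such row;
   - at most p in general.
   The shift makes C(f_i) vanish with probability at most 1/p on each row, so the
   second case has probability about p^-(number of rows) and is beaten by the
   factor kappa, while the third one, which occurs only for the restricted rows,
   leaves p^-(n - alpha - beta). *)

Require Import Defs.
From HB Require Import structures.
From mathcomp Require Import all_boot all_order all_algebra.
From mathcomp Require Import all_fingroup all_solvable all_field all_character.
From mathcomp Require Import all_classical all_reals all_analysis.
From mathcomp Require Import complex zify ring lra.

Import Order.TTheory GRing.Theory Num.Theory.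
Import numFieldNormedType.Exports.

Local Open Scope classical_set_scope.
Local Open Scope ring_scope.

Set Implicit Arguments.
Unset Strict Implicit.

(** * Characters and their masses *)

(** A cyclic group has at most one subgroup of order [p], and [c0] generates it. *)
Lemma Zp_torsion_multiple (a p : nat) (c c0 : 'Z_a) :
  prime p -> c0 != 0 -> c0 *+ p = 0 -> c *+ p = 0 ->
  exists k : 'I_p, c = c0 *+ k.
Proof.
move=> p_pr c0_n0 pc0 pc.
have [-> | c_n0] := eqVneq c 0.
  by exists (Ordinal (prime_gt0 p_pr)); rewrite mulr0n.
have ord x : x != 0 -> x *+ p = 0 -> (#[x : 'Z_a] = p)%g.
  by move=> x0 px; apply: nt_prime_order; rewrite ?FinRing.zmodXgE.
have cycT : cyclic [set: 'Z_a]%SET.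
  by apply/cyclicP; exists Zp1; rewrite Zp_cycle.
have : (c \in <[c0 : 'Z_a]>)%g.
  suff -> : (<[c0]> = <[c : 'Z_a]>)%g by exact: cycle_id.
  apply/eqP; rewrite (eq_subG_cyclic cycT (finset.subsetT _) (finset.subsetT _)).
  by rewrite -[#|_|]/(#[c0]%g) -[X in _ == X]/(#[c]%g) !ord.
case/cyclePmin=> k; rewrite (ord _ c0_n0 pc0) => ltkp ->.
by exists (Ordinal ltkp); rewrite FinRing.zmodXgE.
Qed.

Section Mass.
Variables (a : nat) (G : finZmodType) (R : realType).
Local Notation dual := {ffun G -> 'Z_a}.

(** Values are kept in ['Z_a], so that the induction on [K] involves only real numbers; complex
    roots of unity enter with the Fourier analysis. *)
Definition characters : {set dual} :=
  [set C : dual | [forall x, forall y, C (x + y) == C x + C y]]%SET.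

Lemma charactersD C x y : C \in characters -> C (x + y) = C x + C y.
Proof. by rewrite inE => /forallP/(_ x)/forallP/(_ y)/eqP. Qed.

Lemma characters_zmod_closed : zmod_closed characters.
Proof.
split=> [|C D CP DP].
  by rewrite inE; apply/forallP => x; apply/forallP => y; rewrite !ffunE addr0.
rewrite inE; apply/forallP => x; apply/forallP => y.
by rewrite !ffunE !charactersD // opprD addrACA.
Qed.

Lemma characters0 C : C \in characters -> C 0 = 0.
Proof. by move=> CP; apply: (addIr (C 0)); rewrite -charactersD ?add0r. Qed.

Lemma charactersMn C x k : C \in characters -> C (x *+ k) = C x *+ k.
Proof.
move=> CP; elim: k => [|k IH]; first by rewrite !mulr0n characters0.
by rewrite !mulrS charactersD ?IH.
Qed.

Lemma characters_sum C (I : finType) (F : I -> G) :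
  C \in characters -> C (\sum_i F i) = \sum_i C (F i).
Proof.
move=> CP; apply: (big_morph C) => [x y|]; first exact: charactersD.
exact: characters0.
Qed.

Definition weight (I : finType) (J : {set I}) (C : dual) (f : I -> G) : nat :=
  #|[set i in J | C (f i) != 0]%SET|.

(* With rho bounding the nontrivial character sums of an entry, [mass rho] over all
   characters bounds #|G| times the probability that f kills a random column whose
   free entries are the rows in J. *)
Definition mass (rho : R) (K : {set dual}) (I : finType) (J : {set I})
    (f : I -> G) : R :=
  \sum_(C in K) rho ^+ weight J C f.

Lemma expr_weight (rho : R) (I : finType) (J : {set I}) C (f : I -> G) :
  rho ^+ weight J C f =
  \prod_i (if (i \in J) && (C (f i) != 0) then rho else 1).
Proof.
rewrite -big_mkcond -prodr_const; apply: eq_bigl => i.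
by rewrite inE.
Qed.

Lemma weight0 (I : finType) (J : {set I}) (f : I -> G) : weight J 0 f = 0%N.
Proof. by apply: eq_card0 => i; rewrite !inE ffunE eqxx andbF. Qed.

Section Bounds.
Variables (rho : R) (I : finType) (J : {set I}) (f : I -> G).
Hypothesis rho01 : 0 <= rho <= 1.

Lemma mass_ge1 (K : {set dual}) : 0 \in K -> 1 <= mass rho K J f.
Proof.
move=> K0; rewrite /mass (bigD1 _ K0) /= weight0 expr0 lerDl.
by apply: sumr_ge0 => C _; apply: exprn_ge0; case/andP: rho01.
Qed.

Lemma mass_le_card K : mass rho K J f <= #|K|%:R.
Proof.
rewrite /mass -sumr_const; apply: ler_sum => C _.
by case/andP: rho01 => r0 r1; rewrite exprn_ile1.
Qed.

Let kills (T : {set I}) : {set dual} :=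
  [set C : dual | [forall i in T, (i \in J) ==> (C (f i) == 0)]]%SET.

Let wT (T : {set I}) : R := \prod_i (if i \in T then 1 - rho else rho).

(* [rho ^+ w] is the probability that a random set of rows, each kept with
   probability [1 - rho], avoids [w] given rows. *)
Let mass_random_subset K :
  mass rho K J f = \sum_(T : {set I}) wT T * #|K :&: kills T|%:R.
Proof.
rewrite /mass.
have E C : rho ^+ weight J C f = \sum_(T : {set I}) wT T * (C \in kills T)%:R.
  rewrite expr_weight.
  transitivity (\prod_i ((1 - rho) * (~~ ((i \in J) && (C (f i) != 0)))%:R + rho)).
    apply: eq_bigr => i _; case: (_ && _); rewrite /= ?mulr0 ?mulr1 ?add0r //.
    by rewrite subrK.
  rewrite bigA_distr /=; apply: eq_bigr => T _; rewrite /wT.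
  have [CT|] := boolP (C \in kills T).
    rewrite mulr1; apply: eq_bigr => i _; case: ifP => // iT.
    move: CT; rewrite inE => /forallP/(_ i); rewrite iT /=.
    by case: (i \in J) => //= [/eqP ->|_]; rewrite ?eqxx mulr1.
  rewrite inE fintype.negb_forall => /fintype.existsP[ii]; rewrite !negb_imply => /and3P[iT iJ Ci].
  by rewrite (bigD1 ii) //= iT iJ Ci /= mulr0 mul0r mulr0.
under eq_bigr do rewrite E.
rewrite exchange_big /=; apply: eq_bigr => T _.
rewrite -mulr_sumr -natr_sum; congr (_ * _%:R).
rewrite -sum1_card; under [RHS]eq_bigl do rewrite finset.in_setI.
by rewrite [RHS]big_mkcondr /=; apply: eq_bigr => C _; case: (C \in _).
Qed.

Variables (K : {set dual}) (x : G) (p : nat).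
Hypothesis Kz : zmod_closed K.
Hypotheses (p_pr : prime p) (Kp : {in K, forall C : dual, C x *+ p = 0}).
Let Kx := [set C in K | C x == 0]%SET.

Let kills_zmod_closed T : zmod_closed (kills T).
Proof.
split=> [|C D]; rewrite !inE.
  by apply/forallP => i; rewrite ffunE eqxx !implybT.
move=> /forallP CT /forallP DT; apply/forallP => i.
move: (CT i) (DT i); rewrite !ffunE; case: (i \in T) (i \in J) => [] [] //=.
by move=> /eqP -> /eqP ->; rewrite subr0.
Qed.

(** Evaluation at [x] maps the group [K :&: kills T] to the [p]-torsion of ['Z_a], which has at most
    [p] elements, with kernel [Kx :&: kills T]. *)
Let card_kills_le T : (#|K :&: kills T| <= p * #|Kx :&: kills T|)%N.
Proof.
have [sub|] := boolP (K :&: kills T \subset Kx).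
  rewrite -[leqLHS]mul1n; apply: leq_mul; first exact: prime_gt0.
  apply/subset_leq_card/fintype.subsetP => C CK; rewrite inE.
  by rewrite (fintype.subsetP sub) //; move: CK; rewrite inE => /andP[].
case/fintype.subsetPn => C0; rewrite finset.in_setI => /andP[C0K C0T].
rewrite inE C0K /= => C0x.
rewrite -[X in (X * _)%N]card_ord -cardsT -cardsX.
apply: leq_trans (leq_imset_card (fun kD : 'I_p * dual => kD.2 + C0 *+ kD.1) _).
apply/subset_leq_card/fintype.subsetP => C; rewrite inE => /andP[CK CT].
have [k Ck] := Zp_torsion_multiple p_pr C0x (Kp C0K) (Kp CK).
have closedMn (S : {set dual}) D : zmod_closed S -> D \in S -> D *+ k \in S.
  move=> zS DS; elim: (nat_of_ord k) => [|j IH]; first by case: zS.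
  rewrite mulrS; have [S0 SB] := zS.
  by rewrite -[D *+ j]opprK SB // -sub0r SB.
apply/imsetP; exists (k, C - C0 *+ k); last by rewrite /= subrK.
rewrite !inE /=; have [_ KB] := Kz; rewrite KB ?closedMn //=.
have [_ TB] := kills_zmod_closed T.
rewrite !ffunE Ck /= ffunMnE subrr eqxx /=.
have := TB C (C0 *+ k) CT (closedMn _ _ (kills_zmod_closed T) C0T).
by rewrite inE.
Qed.

Let wT_ge0 T : 0 <= wT T.
Proof.
apply: prodr_ge0 => i _; case/andP: rho01 => r0 r1.
by case: ifP; rewrite ?subr_ge0.
Qed.

(** The index bound holds for each [T], hence on average over the random set of rows. *)
Lemma mass_le_index : mass rho K J f <= p%:R * mass rho Kx J f.
Proof.
rewrite !mass_random_subset mulr_sumr; apply: ler_sum => T _.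
by rewrite mulrCA; apply: ler_wpM2l; rewrite ?wT_ge0 // -natrM ler_nat card_kills_le.
Qed.

(* With probability at least (1 - rho) ^ #|K| the random set of rows contains,
   for every C in K outside Kx, a row on which C does not vanish. *)
Lemma mass_lt_index :
  {in K :\: Kx, forall C : dual, (0 < weight J C f)%N} ->
  mass rho K J f <= p%:R * mass rho Kx J f - (1 - rho) ^+ #|K|.
Proof.
move=> wpos; have [r0 r1] := andP rho01.
(* [I0] collects one witness row per character outside [Kx], hence at most [#|K|] rows. *)
pose wit (C : dual) := [pick i in J | C (f i) != 0].
pose I0 := [set i | [exists C in K :\: Kx, wit C == Some i]]%SET.
have I0card : (#|I0| <= #|K|)%N.
  apply: (@leq_trans #|[set wit C | C in K]%SET|); last exact: leq_imset_card.
  rewrite -(card_imset I0 (@Some_inj _)); apply/subset_leq_card/fintype.subsetP => oi.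
  case/imsetP => i; rewrite inE => /existsP[C /andP[CK /eqP <-]] ->.
  by apply: imset_f; move: CK; rewrite inE => /andP[].
have I0P (T : {set I}) : I0 \subset T -> K :&: kills T = Kx :&: kills T.
  move=> sI; apply/finset.setP => C; rewrite !finset.in_setI; apply: andb_id2r => CT.
  apply/idP/idP => [CK|]; last by rewrite inE => /andP[].
  apply: contraT => CKx; have CD : C \in K :\: Kx by rewrite inE CKx.
  have : (0 < weight J C f)%N by apply: wpos.
  case/card_gt0P => i0; rewrite inE => /andP[i0J Ci0].
  have : wit C != None.
    by rewrite /wit; case: pickP => // /(_ i0); rewrite i0J Ci0.
  case E : (wit C) => [i1|//] _.
  have i1I : i1 \in I0 by rewrite inE; apply/existsP; exists C; rewrite CD E eqxx.
  have /andP[i1J Ci1] : (i1 \in J) && (C (f i1) != 0).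
    by move: E; rewrite /wit; case: pickP => // i2 + [<-].
  move: CT; rewrite inE => /forallP/(_ i1).
  by rewrite (fintype.subsetP sI _ i1I) i1J /= (negPf Ci1).
(* The left side is the probability that the random set contains [I0]. *)
have sumI0 : \sum_(T : {set I}) (I0 \subset T)%:R * wT T = (1 - rho) ^+ #|I0|.
  rewrite -prodr_const [RHS]big_mkcond /=.
  transitivity (\prod_i ((1 - rho) + (if i \in I0 then 0 else rho))).
    rewrite bigA_distr; apply: eq_bigr => T _.
    have [sI|/fintype.subsetPn[i iI iT]] := boolP (I0 \subset T).
      rewrite mul1r; apply: eq_bigr => i _; case: ifP => // iT.
      by case: ifP => // iI; rewrite (fintype.subsetP sI) in iT.
    by rewrite mul0r (bigD1 i) //= (negPf iT) iI mul0r.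
  by apply: eq_bigr => i _; case: ifP; rewrite ?addr0 ?subrK.
apply: (@le_trans _ _ (p%:R * mass rho Kx J f - (1 - rho) ^+ #|I0|)).
  rewrite -sumI0 !mass_random_subset mulr_sumr -sumrB; apply: ler_sum => T _.
  rewrite mulrCA [X in _ - X]mulrC -mulrBr; apply: ler_wpM2l; first exact: wT_ge0.
  have [sI|_] := boolP (I0 \subset T); last first.
    by rewrite subr0 -natrM ler_nat card_kills_le.
  (* Both counts are now the same number, positive because of the zero character, so [p >= 2] leaves
     a gap of at least 1. *)
  rewrite (I0P _ sI) lerBrDr -natrM -natrD ler_nat.
  have p2 := prime_gt1 p_pr.
  have : (0 < #|Kx :&: kills T|)%N.
    apply/card_gt0P; exists 0; have [K0 _] := Kz; have [T0 _] := kills_zmod_closed T.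
    by rewrite finset.in_setI T0 inE K0 ffunE eqxx.
  nia.
rewrite lerD2l lerN2; apply: ler_wiXn2l => //; rewrite ?subr_ge0 //.
by rewrite lerBlDr lerDl.
Qed.

End Bounds.
End Mass.
(** * Real estimates *)

Section RealBounds.
Variable R : realType.

Lemma expr_small (x d : R) : 0 <= x < 1 -> 0 < d ->
  exists m0, forall m, (m0 <= m)%N -> x ^+ m <= d.
Proof.
move=> /andP[x0 x1] d0.
have /(_ _)/cvgrPdist_le := @cvg_expr R x; rewrite ger0_norm // => /(_ x1 d d0).
case=> m0 _ H; exists m0 => m mm; have := H m mm.
by rewrite /= sub0r normrN ger0_norm // exprn_ge0.
Qed.

(** A division-free form of [(1 + y) ^ N <= 1 / (1 - N y)], valid also when [N y >= 1]. *)
Lemma expr1D_le (y : R) N : 0 <= y -> (1 + y) ^+ N * (1 - N%:R * y) <= 1.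
Proof.
move=> y0; elim: N => [|N IH]; first by rewrite expr0 mul0r subr0 mul1r.
apply: le_trans IH; rewrite exprSr -mulrA; apply: ler_wpM2l.
  by rewrite exprn_ge0 ?addr_ge0.
have : 0 <= N%:R * y * y by rewrite !mulr_ge0.
have : 0 <= y * y by rewrite mulr_ge0.
rewrite -natr1; lra.
Qed.

(** [t ^+ k] is the smallest of the first [k + 1] terms of the geometric series. *)
Lemma natr_expr_le (t : R) k : 0 <= t < 1 -> k.+1%:R * t ^+ k <= (1 - t)^-1.
Proof.
move=> /andP[t0 t1].
have t10 : 0 < 1 - t by rewrite subr_gt0.
rewrite -[leRHS]mul1r ler_pdivlMr //.
apply: (@le_trans _ _ ((\sum_(i < k.+1) t ^+ i) * (1 - t))).
  apply: ler_wpM2r; first exact: ltW.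
  rewrite -[k.+1 in leLHS]card_ord mulr_natl -sumr_const; apply: ler_sum => i _.
  by apply: ler_wiXn2l; rewrite ?(ltW t1) //= -ltnS.
rewrite mulrC -opprB mulNr -subrX1 opprB lerBlDr lerDl exprn_ge0 //.
Qed.

(** The product tends to 1 because [N * rho ^ (N / L)] tends to 0. *)
Lemma expr1D_expr_limit (rho c d : R) (L : nat) :
  0 <= rho < 1 -> 0 <= c -> (0 < L)%N -> 0 < d ->
  exists m0, forall N, (m0 <= N)%N -> (1 + c * rho ^+ (N %/ L)) ^+ N <= 1 + d.
Proof.
move=> /andP[r0 r1] c0 L0 d0.
(* By the inequality of means [rho <= t ^ 2]: one factor [t ^+ k] absorbs the linear factor [N], the
   other tends to 0. *)
pose t := (1 + rho) / 2%:R.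
have t01 : 0 <= t < 1 by rewrite /t; apply/andP; split; lra.
have [t0 t1] := andP t01.
have t10 : 0 < 1 - t by rewrite subr_gt0.
have rt : rho <= t * t by rewrite /t; nra.
(* Chosen so that [(1 - e)^-1 = 1 + d]. *)
pose e := d / (1 + d).
have e0 : 0 < e by rewrite divr_gt0 // addr_gt0.
pose b := c * L%:R * (1 - t)^-1.
have b0 : 0 <= b by rewrite !mulr_ge0 // invr_ge0 ltW.
have [k0 Hk0] := @expr_small t (e / (1 + b)) t01 (divr_gt0 e0 (ltr_wpDr b0 ltr01)).
exists (k0 * L)%N => N leN; set k := (N %/ L)%N.
have kk : (k0 <= k)%N by rewrite leq_divRL.
have y0 : 0 <= c * rho ^+ k by rewrite mulr_ge0 // exprn_ge0.
have Ny : N%:R * (c * rho ^+ k) <= e.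
  apply: (@le_trans _ _ (b * t ^+ k)); last first.
    apply: (@le_trans _ _ ((1 + b) * t ^+ k)).
      by apply: ler_wpM2r; rewrite ?exprn_ge0 // lerDr ler01.
    by rewrite mulrC -ler_pdivlMr ?Hk0 // ltr_wpDr.
  apply: (@le_trans _ _ ((L * k.+1)%:R * (c * (t ^+ k * t ^+ k)))).
    apply: ler_pM => //; first by rewrite ler_nat mulnC ltnW // ltn_ceil.
    apply: ler_wpM2l => //; rewrite -exprMn.
    by apply: lerXn2r; rewrite // nnegrE // mulr_ge0.
  rewrite /b natrM.
  have -> : L%:R * k.+1%:R * (c * (t ^+ k * t ^+ k)) =
    c * L%:R * (k.+1%:R * t ^+ k) * t ^+ k by ring.
  apply: ler_wpM2r; first exact: exprn_ge0.
  by apply: ler_wpM2l; rewrite ?mulr_ge0 // natr_expr_le.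
have := expr1D_le N y0.
have Xge0 : 0 <= (1 + c * rho ^+ k) ^+ N by rewrite exprn_ge0 ?addr_ge0.
move=> H; have {}H : (1 + c * rho ^+ k) ^+ N * (1 - e) <= 1.
  by apply: le_trans H; apply: ler_wpM2l => //; rewrite lerD2l lerN2.
have -> : 1 + d = (1 - e)^-1.
  by rewrite /e; field; apply/andP; split; apply: lt0r_neq0; lra.
rewrite -[leRHS]mul1r ler_pdivlMr //.
suff : e < 1 by rewrite subr_gt0.
by rewrite /e ltr_pdivrMr; lra.
Qed.

(* P kappa >= 1, tau, lambda >= 1: raising the exponents to the maximum allowed
   produces exactly the power of [kappa * lambda * tau ^ 2]. *)
Lemma expr_product_le (P kappa tau lambda : R) (m n e1 e2 e3 : nat) :
  0 <= P -> 0 <= kappa -> 1 <= P * kappa -> 1 <= tau -> 1 <= lambda ->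
  kappa * lambda * tau ^+ 2 <= 1 ->
  (m <= n)%N -> (e1 <= n)%N -> (e2 <= 2 * n)%N -> (e3 <= n)%N ->
  (P * kappa) ^+ e1 * tau ^+ e2 * lambda ^+ e3 <=
  P ^+ n * (kappa * lambda * tau ^+ 2) ^+ m.
Proof.
move=> P0 k0 Pk t1 l1 mu1 mn le1 le2 le3.
have t0 : 0 <= tau by apply: le_trans t1.
have l0 : 0 <= lambda by apply: le_trans l1.
apply: (@le_trans _ _ ((P * kappa) ^+ n * tau ^+ (2 * n) * lambda ^+ n)).
  by rewrite !ler_pM ?mulr_ge0 ?exprn_ge0 ?ler_weXn2l // mulr_ge0.
have -> : (P * kappa) ^+ n * tau ^+ (2 * n) * lambda ^+ n =
  P ^+ n * (kappa * lambda * tau ^+ 2) ^+ n.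
  by rewrite exprM !exprMn; ring.
apply: ler_wpM2l; first exact: exprn_ge0.
by apply: ler_wiXn2l => //; rewrite !mulr_ge0 ?exprn_ge0.
Qed.

End RealBounds.
(** * Averaging over shifts *)

Section Shifts.
Variables (a : nat) (G : finZmodType) (R : realType).
Local Notation dual := {ffun G -> 'Z_a}.

(** The form in which surjectivity enters the induction; unlike surjectivity itself it is relative
    to [K], and it passes to [Kx]. *)
Definition detected (K : {set dual}) (I : finType) (f : I -> G) : bool :=
  [forall C in K, (C != 0) ==> (0 < weight [set: I]%SET C f)%N].

Definition shift (I : finType) (p : nat) (x : G) (f : {ffun I -> G})
    (k : {ffun I -> 'I_p}) : {ffun I -> G} :=
  [ffun i => f i + x *+ k i].

(** Each shift permutes the tuples, so averaging over shifts preserves the total. *)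
Lemma sum_shift (I : finType) (p : nat) (x : G) (Phi : {ffun I -> G} -> R) :
  p%:R ^+ #|I| * \sum_f Phi f = \sum_f \sum_k Phi (@shift I p x f k).
Proof.
rewrite exchange_big /=.
transitivity (\sum_(k : {ffun I -> 'I_p}) \sum_f Phi f).
  by rewrite sumr_const card_ffun card_ord -natrX mulr_natl.
apply: eq_bigr => k _; rewrite (@reindex_inj _ _ _ _ (fun f => shift x f k)) //.
move=> f g /ffunP fg; apply/ffunP => i.
by have := fg i; rewrite !ffunE => /addIr.
Qed.

Lemma leq_weight (I : finType) (J J' : {set I}) (C : dual) (f : I -> G) :
  J \subset J' -> (weight J C f <= weight J' C f)%N.
Proof.
move=> sJ; apply/subset_leq_card/fintype.subsetP => i; rewrite !inE => /andP[iJ ->].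
by rewrite (fintype.subsetP sJ).
Qed.

(** * Effect of the shifts by multiples of [x] on weights and masses *)

Section Step.
Variables (K : {set dual}) (x : G) (p : nat).
Hypotheses (Kchar : K \subset characters a G) (Kz : zmod_closed K).
Hypotheses (p_pr : prime p) (Kp : {in K, forall C : dual, C x *+ p = 0}).
Let Kx := [set C in K | C x == 0]%SET.
Variables (I : finType) (J : {set I}).

(** Characters in [Kx] vanish at [x], so they do not see the shift. *)
Lemma weight_shift (J' : {set I}) C (f : {ffun I -> G}) (k : {ffun I -> 'I_p}) :
  C \in Kx -> weight J' C (shift x f k) = weight J' C f.
Proof.
rewrite inE => /andP[CK /eqP Cx]; apply: eq_card => i; rewrite !inE ffunE.
by rewrite charactersD ?charactersMn ?(fintype.subsetP Kchar) // Cx mul0rn addr0.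
Qed.

Lemma mass_shift rho (J' : {set I}) (f : {ffun I -> G}) (k : {ffun I -> 'I_p}) :
  mass rho Kx J' (shift x f k) = mass rho Kx J' f :> R.
Proof. by apply: eq_bigr => C CK; rewrite weight_shift. Qed.

Lemma detected_shift (f : {ffun I -> G}) (k : {ffun I -> 'I_p}) :
  detected K (shift x f k) -> detected Kx f.
Proof.
move=> /fintype.forallP det; apply/fintype.forallP => C; apply/implyP => CK.
rewrite -(weight_shift _ _ k) //; move/implyP: (det C); apply.
by move: CK; rewrite inE => /andP[].
Qed.

(** [C x] has order exactly [p], so [C (y + x *+ t)] vanishes for at most one [t]. *)
Lemma sum_torsion_shift (C : dual) (y : G) (s : R) : 0 <= s -> C \in K :\: Kx ->
  \sum_(t < p) (if C (y + x *+ t) != 0 then s else 1) <= 1 + p%:R * s.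
Proof.
move=> s0; rewrite !inE => /andP[+ CK]; rewrite CK /= => Cx.
have CP := fintype.subsetP Kchar _ CK.
apply: (@le_trans _ _ (\sum_(t < p) (s + (C (y + x *+ t) == 0)%:R))).
  by apply: ler_sum => t _; case: eqP; rewrite ?addr0 ?lerDr.
rewrite big_split /= sumr_const card_ord mulr_natl addrC lerD2r.
rewrite -natr_sum -[leRHS]/(1%:R) ler_nat.
rewrite -big_mkcond /= sum1_card; apply/fintype.card_le1_eqP => t t' tP t'P.
have Et : C (y + x *+ t) = 0 by apply/eqP.
have Et' : C (y + x *+ t') = 0 by apply/eqP.
rewrite !charactersD // !charactersMn // in Et Et'.
have E : C x *+ t = C x *+ t' by apply: (addrI (C y)); rewrite Et Et'.
apply: val_inj.
have oC : (#[C x : 'Z_a] = p)%g.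
  by apply: nt_prime_order; rewrite ?FinRing.zmodXgE ?Kp.
have := eq_expg_mod_order (C x : 'Z_a) t t'.
by rewrite !FinRing.zmodXgE E eqxx oC !modn_small // => /esym/eqP.
Qed.

(** The rows are shifted independently, so the sum factors: a row of [J'] costs [1 + p * s], any
    other row [p]. *)
Lemma sum_expr_weight (C : dual) (J' : {set I}) (f : {ffun I -> G}) (s : R) :
  0 <= s -> C \in K :\: Kx ->
  \sum_(k : {ffun I -> 'I_p}) s ^+ weight J' C (shift x f k) <=
  (1 + p%:R * s) ^+ #|J'| * p%:R ^+ #|~: J'|.
Proof.
move=> s0 CK.
under eq_bigr do rewrite expr_weight.
pose F i (t : 'I_p) : R := if (i \in J') && (C (f i + x *+ t) != 0) then s else 1.
have -> : \sum_(k : {ffun I -> 'I_p})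
    \prod_i (if (i \in J') && (C (shift x f k i) != 0) then s else 1) =
    \prod_i \sum_t F i t.
  rewrite bigA_distr_bigA; apply: eq_bigr => k _; apply: eq_bigr => i _.
  by rewrite ffunE.
have -> : (1 + p%:R * s) ^+ #|J'| * p%:R ^+ #|~: J'| =
    \prod_i (if i \in J' then 1 + p%:R * s else p%:R).
  rewrite (bigID (mem J')) /= -!prodr_const; congr (_ * _).
    by apply: eq_bigr => i ->.
  by apply: eq_big => i; rewrite ?inE // => /negPf ->.
apply: ler_prod => i _; apply/andP; split.
  by apply: sumr_ge0 => t _; rewrite /F; case: ifP.
rewrite /F; case: (i \in J') => /=; first exact: sum_torsion_shift.
by rewrite sumr_const card_ord.
Qed.

(** The two characters read disjoint sets of rows, so the sum still factors. *)
Lemma sum_expr_weight2 (C C' : dual) (f : {ffun I -> G}) (s s' : R) :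
  0 <= s -> 0 <= s' -> C \in K :\: Kx -> C' \in K :\: Kx ->
  \sum_(k : {ffun I -> 'I_p})
     s ^+ weight (~: J) C (shift x f k) * s' ^+ weight J C' (shift x f k) <=
  (1 + p%:R * s) ^+ #|~: J| * (1 + p%:R * s') ^+ #|J|.
Proof.
move=> s0 s0' CK CK'.
under eq_bigr do rewrite !expr_weight -big_split /=.
pose F i (t : 'I_p) : R :=
  if i \in J then if C' (f i + x *+ t) != 0 then s' else 1
  else if C (f i + x *+ t) != 0 then s else 1.
rewrite (_ : \sum_(k : _) _ = \prod_i \sum_t F i t); last first.
  rewrite bigA_distr_bigA; apply: eq_bigr => k _; apply: eq_bigr => i _.
  by rewrite ffunE inE /F; case: (i \in J); rewrite /= ?mul1r ?mulr1.
have -> : (1 + p%:R * s) ^+ #|~: J| * (1 + p%:R * s') ^+ #|J| =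
    \prod_i (if i \in J then 1 + p%:R * s' else 1 + p%:R * s).
  rewrite mulrC (bigID (mem J)) /= -!prodr_const; congr (_ * _).
    by apply: eq_bigr => i ->.
  by apply: eq_big => i; rewrite ?inE // => /negPf ->.
apply: ler_prod => i _; apply/andP; split.
  by apply: sumr_ge0 => t _; rewrite /F; do 2?case: ifP.
by rewrite /F; case: (i \in J); exact: sum_torsion_shift.
Qed.

Variables (rho sigma : R) (L : nat).
Hypotheses (rho01 : 0 <= rho < 1) (sigma01 : 0 < sigma <= 1) (L_gt0 : (0 < L)%N).
(** Turns the absolute gain [(1 - rho) ^+ #|K|] of [mass_lt_index] into a relative one, using that
    the mass over [Kx] is at most [#|K|]. *)
Definition contraction : R := 1 - (1 - rho) ^+ #|K| / (p%:R * #|K|%:R).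
Local Notation kappa := contraction.

Let rho_le1 : 0 <= rho <= 1.
Proof. by case/andP: rho01 => -> /ltW. Qed.

Let cardK_gt0 : (0 < #|K|)%N.
Proof. by apply/card_gt0P; exists 0; case: Kz. Qed.

(** The lower bound yields [1 <= p * kappa], which [expr_product_le] requires. *)
Lemma contraction_bounds : 1 / 2%:R <= kappa < 1.
Proof.
have [r0 r1] := andP rho01.
have p2 : 2%:R <= p%:R :> R by rewrite ler_nat prime_gt1.
have K1 : 1 <= #|K|%:R :> R by rewrite -[1]/(1%:R) ler_nat cardK_gt0.
have D2 : 2%:R <= p%:R * #|K|%:R :> R by rewrite -[leLHS]mulr1 ler_pM.
have D0 : 0 < p%:R * #|K|%:R :> R by apply: lt_le_trans D2; rewrite ltr0n.
have q0 : 0 < (1 - rho) ^+ #|K| by rewrite exprn_gt0 // subr_gt0.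
have q1 : (1 - rho) ^+ #|K| <= 1 by apply: exprn_ile1; rewrite ?subr_ge0 ?(ltW r1) ?lerBlDr ?lerDl.
have : 0 < (1 - rho) ^+ #|K| / (p%:R * #|K|%:R) by rewrite divr_gt0.
have : (1 - rho) ^+ #|K| / (p%:R * #|K|%:R) <= 1 / 2%:R.
  by rewrite ler_pdivrMr // (le_trans q1) // mul1r mulrC ler_pdivlMr ?mul1r.
rewrite /contraction => h1 h2; rewrite ltrBlDr ltrDl h2 andbT lerBrDr.
by apply: (le_trans (lerD (lexx _) h1)); rewrite -splitr.
Qed.

Let Kx0 : 0 \in Kx.
Proof. by rewrite inE ffunE eqxx; case: Kz => ->. Qed.

Lemma mass_contract (J' : {set I}) (f : I -> G) :
  {in K :\: Kx, forall C : dual, (0 < weight J' C f)%N} ->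
  mass rho K J' f <= p%:R * kappa * mass rho Kx J' f.
Proof.
move=> /(mass_lt_index rho_le1 Kz p_pr Kp) => H; apply: le_trans H _.
have p0 : 0 < p%:R :> R by rewrite ltr0n prime_gt0.
have K0 : 0 < #|K|%:R :> R by rewrite ltr0n cardK_gt0.
rewrite -/Kx /contraction mulrBr mulr1 mulrBl lerD2l lerN2.
have -> : p%:R * ((1 - rho) ^+ #|K| / (p%:R * #|K|%:R)) * mass rho Kx J' f =
  (1 - rho) ^+ #|K| * (mass rho Kx J' f / #|K|%:R).
  by field; rewrite !lt0r_neq0.
rewrite -[leRHS]mulr1; apply: ler_wpM2l.
  by rewrite exprn_ge0 // subr_ge0 ltW //; case/andP: rho01.
rewrite ler_pdivrMr // mul1r; apply: le_trans (mass_le_card _ _ rho_le1 _) _.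
by rewrite ler_nat; apply/subset_leq_card/fintype.subsetP => C; rewrite inE => /andP[].
Qed.

(** The three summands cover three regimes: all weights outside [Kx] exceed [Th / L], some positive
    weight does not, or some weight is 0. The indicators of the last two are replaced by bounds that
    factor over the rows: [0 ^+ weight], where [0 ^+ 0 = 1], and the exponential Markov factor
    [sigma^-1 ^+ Th * (sigma ^+ L) ^+ weight], which is at least 1 when [L * weight <= Th]. *)
Lemma mass_expr_le (J' : {set I}) (f : I -> G) (N Th : nat) : (N <= Th)%N ->
  mass rho K J' f ^+ N <= mass rho Kx J' f ^+ N *
  ((1 + #|K|%:R * rho ^+ (Th %/ L)) ^+ Th
   + (p%:R * kappa) ^+ N * sigma^-1 ^+ Th *
     \sum_(C in K :\: Kx) (sigma ^+ L) ^+ weight J' C f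
   + p%:R ^+ N * \sum_(C in K :\: Kx) 0 ^+ weight J' C f).
Proof.
move=> NTh; have [r0 /ltW r1] := andP rho01; have [s0 s1] := andP sigma01.
have [k0 k1] := andP contraction_bounds.
have p0 : 0 <= p%:R :> R by [].
have pk0 : 0 <= p%:R * kappa by rewrite mulr_ge0 // (le_trans _ k0).
have Mb1 := mass_ge1 J' f rho_le1 Kx0.
have Mb0 : 0 <= mass rho Kx J' f by apply: le_trans Mb1.
have M0 : 0 <= mass rho K J' f by apply: sumr_ge0 => C _; rewrite exprn_ge0.
have A0 : 0 <= (1 + #|K|%:R * rho ^+ (Th %/ L)) ^+ Th.
  by rewrite exprn_ge0 // addr_ge0 // mulr_ge0 // exprn_ge0.
have s00 : 0 <= sigma^-1 by rewrite invr_ge0 ltW.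
have t20 : 0 <= (p%:R * kappa) ^+ N * sigma^-1 ^+ Th *
     \sum_(C in K :\: Kx) (sigma ^+ L) ^+ weight J' C f.
  rewrite !mulr_ge0 ?exprn_ge0 //.
  by apply: sumr_ge0 => C _; rewrite !exprn_ge0 // ltW.
have t30 : 0 <= p%:R ^+ N * \sum_(C in K :\: Kx) 0 ^+ weight J' C f :> R.
  by rewrite mulr_ge0 ?exprn_ge0 // sumr_ge0 // => C _; rewrite exprn_ge0.
have [/fintype.existsP[C /andP[CK /eqP w0]]|] :=
  boolP [exists C in K :\: Kx, weight J' C f == 0%N].
  apply: (@le_trans _ _ (mass rho Kx J' f ^+ N * p%:R ^+ N)).
    rewrite -exprMn mulrC; apply: lerXn2r; rewrite ?nnegrE ?mulr_ge0 //.
    exact: (mass_le_index _ _ rho_le1 Kz p_pr Kp).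
  apply: ler_wpM2l; first exact: exprn_ge0.
  rewrite -[leLHS]add0r lerD ?addr_ge0 //.
  rewrite -[leLHS]mulr1; apply: ler_wpM2l; first exact: exprn_ge0.
  rewrite (bigD1 C) //= w0 expr0 lerDl.
  by apply: sumr_ge0 => D _; rewrite exprn_ge0.
rewrite fintype.negb_exists => /fintype.forallP w0.
have {}w0 : {in K :\: Kx, forall C : dual, (0 < weight J' C f)%N}.
  by move=> C CK; have := w0 C; rewrite CK /= lt0n.
have [/fintype.existsP[C /andP[CK lw]]|] :=
  boolP [exists C in K :\: Kx, (L * weight J' C f <= Th)%N].
  apply: (@le_trans _ _ (mass rho Kx J' f ^+ N * (p%:R * kappa) ^+ N)).
    rewrite -exprMn mulrC; apply: lerXn2r; rewrite ?nnegrE ?(mulr_ge0 pk0 Mb0) //.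
    exact: mass_contract.
  apply: ler_wpM2l; first exact: exprn_ge0.
  rewrite -[leLHS]addr0 lerD // -[leLHS]add0r lerD //.
  rewrite -[leLHS]mulr1 -mulrA; apply: ler_wpM2l; first exact: exprn_ge0.
  rewrite (bigD1 C) //= mulrDr -[leLHS]addr0; apply: lerD; last first.
    rewrite mulr_ge0 ?exprn_ge0 //.
    by apply: sumr_ge0 => D _; rewrite !exprn_ge0 // ltW.
  rewrite -exprM -(subnKC lw) exprD mulrAC -exprMn mulVf ?lt0r_neq0 // expr1n mul1r.
  by apply: exprn_ege1; rewrite invf_ge1.
rewrite fintype.negb_exists => /fintype.forallP lw.
apply: (@le_trans _ _ (mass rho Kx J' f ^+ N * (1 + #|K|%:R * rho ^+ (Th %/ L)) ^+ Th)).
  apply: (@le_trans _ _ (mass rho Kx J' f ^+ N * (1 + #|K|%:R * rho ^+ (Th %/ L)) ^+ N)); last first.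
    apply: ler_wpM2l; first exact: exprn_ge0.
    by apply: ler_weXn2l => //; rewrite lerDl mulr_ge0 // exprn_ge0.
  rewrite -exprMn; apply: lerXn2r; rewrite ?nnegrE ?mulr_ge0 //.
    by rewrite addr_ge0 // mulr_ge0 // exprn_ge0.
  (* The mass over [Kx] is at least 1, so an additive excess is also a relative one. *)
  apply: (@le_trans _ _ (mass rho Kx J' f + #|K|%:R * rho ^+ (Th %/ L))); last first.
    rewrite mulrDr mulr1 lerD2l -[leLHS]mul1r; apply: ler_wpM2r => //.
    by rewrite mulr_ge0 // exprn_ge0.
  rewrite /mass (big_setID Kx) /=; apply: lerD.
    rewrite (_ : K :&: Kx = Kx) //; apply/finset.setIidPr/fintype.subsetP => C.
    by rewrite inE => /andP[].
  apply: (@le_trans _ _ (\sum_(C in K :\: Kx) rho ^+ (Th %/ L))).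
    apply: ler_sum => C CK; apply: ler_wiXn2l => //.
    have := lw C; rewrite CK /= -ltnNge => /ltnW.
    by move/(leq_div2r L); rewrite mulKn.
  rewrite sumr_const -[_ *+ _]mulr_natl; apply: ler_wpM2r; first exact: exprn_ge0.
  by rewrite ler_nat subset_leq_card // finset.subsetDl.
apply: ler_wpM2l; first exact: exprn_ge0.
by rewrite -[leLHS]addr0 lerD // -[leLHS]addr0 lerD.
Qed.

End Step.
End Shifts.

(** * The averaged bound for one step from [K] to [Kx] *)

Section Step.
Variables (a : nat) (G : finZmodType) (R : realType).
Local Notation dual := {ffun G -> 'Z_a}.
Variables (K : {set dual}) (x : G) (p : nat).
Hypotheses (Kchar : K \subset characters a G) (Kz : zmod_closed K).
Hypotheses (p_pr : prime p) (Kp : {in K, forall C : dual, C x *+ p = 0}).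
Let Kx := [set C in K | C x == 0]%SET.
Variables (I : finType) (J : {set I}).
Variables (rho sigma : R) (L : nat).
Hypotheses (rho01 : 0 <= rho < 1) (sigma01 : 0 < sigma <= 1) (L_gt0 : (0 < L)%N).
Local Notation kappa := (contraction K p rho).
(** The net cost of a spare row: [kappa] from the contraction, [1 + p * sigma ^+ L] from the shifts
    of the row, and one [sigma^-1] from the Markov factor of each of the two masses. *)
Local Notation mu := (kappa * (1 + p%:R * sigma ^+ L) * sigma^-1 ^+ 2).
Hypothesis mu_le1 : mu <= 1.
Local Notation Amp N := ((1 + #|K|%:R * rho ^+ (N %/ L)) ^+ N).

(** In the application [#|~: J| = alpha], [N1 = n - beta], [N2 = beta] and
    [m = n - alpha - beta]. *)
Variables (m N1 N2 : nat).
Hypotheses (N1E : N1 = (#|~: J| + m)%N) (JE : #|J| = (N2 + m)%N).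

Let s : R := sigma ^+ L.
Let c : R := #|K|%:R.
Let T1 (f : {ffun I -> G}) := \sum_(C in K :\: Kx) s ^+ weight [set: I]%SET C f.
Let T2 (f : {ffun I -> G}) := \sum_(C in K :\: Kx) s ^+ weight J C f.
Let T3 (f : {ffun I -> G}) : R := \sum_(C in K :\: Kx) 0 ^+ weight J C f.
Let E1 := (p%:R * kappa) ^+ N1 * sigma^-1 ^+ N1.
Let E2 := (p%:R * kappa) ^+ N2 * sigma^-1 ^+ #|J|.

Let s_ge0 : 0 <= s.
Proof. by rewrite exprn_ge0 // ltW //; case/andP: sigma01. Qed.

Let s_le1 : s <= 1.
Proof. by case/andP: sigma01 => s0 s1; rewrite exprn_ile1 // ltW. Qed.

Let nE : #|I| = (#|~: J| + N2 + m)%N.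
Proof. by rewrite -(cardsC J) JE addnC addnA. Qed.

Let sumr_le_card (F : dual -> R) (b : R) : 0 <= b ->
  {in K :\: Kx, forall C, F C <= b} -> \sum_(C in K :\: Kx) F C <= c * b.
Proof.
move=> b0 Fb; apply: (@le_trans _ _ (\sum_(C in K :\: Kx) b)).
  by apply: ler_sum => C /Fb.
rewrite sumr_const -[_ *+ _]mulr_natl; apply: ler_wpM2r => //.
by rewrite ler_nat subset_leq_card // finset.subsetDl.
Qed.

Let lambda_ge1 : 1 <= 1 + p%:R * s.
Proof. by rewrite lerDl mulr_ge0. Qed.

Let lambda_ge0 : 0 <= 1 + p%:R * s.
Proof. exact: le_trans lambda_ge1. Qed.

Let sumT2 f : \sum_(k : {ffun I -> 'I_p}) T2 (shift x f k) <=
  c * ((1 + p%:R * s) ^+ #|J| * p%:R ^+ #|~: J|).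
Proof.
rewrite exchange_big /=; apply: sumr_le_card => [|C CK].
  by rewrite mulr_ge0 ?exprn_ge0.
exact: (sum_expr_weight Kchar p_pr Kp J f s_ge0 CK).
Qed.

Let sumT3 f : \sum_(k : {ffun I -> 'I_p}) T3 (shift x f k) <= c * p%:R ^+ #|~: J|.
Proof.
rewrite exchange_big /=; apply: sumr_le_card => [|C CK]; first by rewrite exprn_ge0.
have := sum_expr_weight Kchar p_pr Kp J f (lexx (0 : R)) CK.
by rewrite mulr0 addr0 expr1n mul1r.
Qed.

Let sumT1 f : \sum_(k : {ffun I -> 'I_p}) T1 (shift x f k) <=
  c * (1 + p%:R * s) ^+ #|I|.
Proof.
rewrite exchange_big /=; apply: sumr_le_card => [|C CK]; first by rewrite exprn_ge0.
have := sum_expr_weight Kchar p_pr Kp [set: I]%SET f s_ge0 CK.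
by rewrite finset.setCT cards0 expr0 mulr1 cardsT.
Qed.

(** Restricting the first weight to [~: J] only increases the power of [s], as [s <= 1], and makes
    the two characters read disjoint rows. *)
Let sumT1T f (s' : R) : 0 <= s' ->
  \sum_(k : {ffun I -> 'I_p}) (T1 (shift x f k) *
     \sum_(C in K :\: Kx) s' ^+ weight J C (shift x f k)) <=
  c * (c * ((1 + p%:R * s) ^+ #|~: J| * (1 + p%:R * s') ^+ #|J|)).
Proof.
move=> s0'.
have b0 : 0 <= (1 + p%:R * s) ^+ #|~: J| * (1 + p%:R * s') ^+ #|J|.
  by rewrite mulr_ge0 ?exprn_ge0 // addr_ge0 ?mulr_ge0.
under eq_bigr do rewrite mulr_suml.
rewrite exchange_big /=; apply: sumr_le_card => [|C CK]; first by rewrite mulr_ge0.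
under eq_bigr do rewrite mulr_sumr.
rewrite exchange_big /=; apply: sumr_le_card => [|C' CK'] //.
apply: le_trans (sum_expr_weight2 Kchar p_pr Kp J f s_ge0 s0' CK CK').
apply: ler_sum => k _; apply: ler_wpM2r; first exact: exprn_ge0.
by apply: ler_wiXn2l => //; rewrite leq_weight // finset.subsetT.
Qed.

(** The regime bounds of the two masses are multiplied and summed over the shifts. The product of
    the first regimes gives the main term; each product involving another regime carries
    [mu ^+ m]. *)
Lemma sum_shift_mass (f : {ffun I -> G}) :
  \sum_(k : {ffun I -> 'I_p}) (detected K (shift x f k))%:R *
     (mass rho K [set: I]%SET (shift x f k) ^+ N1 * mass rho K J (shift x f k) ^+ N2)
  <= p%:R ^+ #|I| * ((detected Kx f)%:R *
     (mass rho Kx [set: I]%SET f ^+ N1 * mass rho Kx J f ^+ N2)) *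
     (Amp N1 * Amp #|J| + (2%:R * #|K|%:R * Amp N1 + #|K|%:R * Amp #|J| +
        2%:R * #|K|%:R * #|K|%:R) * mu ^+ m).
Proof.
have [r0 /ltW r1] := andP rho01; have [s0 s1] := andP sigma01.
have [k0 k1] := andP (contraction_bounds Kz p_pr rho01).
have k00 : 0 <= kappa by apply: le_trans k0.
have P0 : 0 <= p%:R :> R by [].
have pk1 : 1 <= p%:R * kappa.
  apply: (@le_trans _ _ (2%:R * (1 / 2%:R))); first by rewrite mul1r divff.
  by rewrite ler_pM // ?ler_nat ?prime_gt1 // divr_ge0.
have pk0 : 0 <= p%:R * kappa by apply: le_trans pk1.
have t1 : 1 <= sigma^-1 by rewrite invf_ge1.
have t0 : 0 <= sigma^-1 by apply: le_trans t1.
have c0 : 0 <= c by [].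
have A0 N : 0 <= Amp N by rewrite exprn_ge0 // addr_ge0 // mulr_ge0 // exprn_ge0.
have E10 : 0 <= E1 by rewrite mulr_ge0 ?exprn_ge0.
have E20 : 0 <= E2 by rewrite mulr_ge0 ?exprn_ge0.
have mass0 (K' : {set dual}) J' (g : {ffun I -> G}) : 0 <= mass rho K' J' g.
  by apply: sumr_ge0 => C _; rewrite exprn_ge0.
pose Mx := mass rho Kx [set: I]%SET f ^+ N1 * mass rho Kx J f ^+ N2.
have Mx0 : 0 <= Mx by rewrite mulr_ge0 ?exprn_ge0.
pose Bd (g : {ffun I -> G}) := (Amp N1 + E1 * T1 g) *
  (Amp #|J| + E2 * T2 g + p%:R ^+ N2 * T3 g).
have T0 (s' : R) J' (g : {ffun I -> G}) : 0 <= s' ->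
    0 <= \sum_(C in K :\: Kx) s' ^+ weight J' C g.
  by move=> s0'; apply: sumr_ge0 => C _; rewrite exprn_ge0.
have Bd0 g : 0 <= Bd g.
  by rewrite mulr_ge0 ?addr_ge0 // mulr_ge0 ?exprn_ge0 // T0.
have pointwise (k : {ffun I -> 'I_p}) : (detected K (shift x f k))%:R *
     (mass rho K [set: I]%SET (shift x f k) ^+ N1 * mass rho K J (shift x f k) ^+ N2)
   <= (detected Kx f)%:R * Mx * Bd (shift x f k).
  have [det|_] := boolP (detected K (shift x f k)); last first.
    by rewrite mul0r; apply: mulr_ge0 => //; apply: mulr_ge0.
  rewrite (detected_shift Kchar det) !mul1r.
  (* The threshold for the restricted columns is [#|J| = N2 + m], because [N2] alone may stay
     bounded. *)
  have NJ : (N2 <= #|J|)%N by rewrite JE leq_addr.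
  have := mass_expr_le Kz p_pr Kp rho01 sigma01 L_gt0 [set: I]%SET (shift x f k) (leqnn N1).
  have := mass_expr_le Kz p_pr Kp rho01 sigma01 L_gt0 J (shift x f k) NJ.
  move=> H2 H1.
  rewrite /Mx /Bd -(mass_shift x Kchar rho _ f k) -(mass_shift x Kchar rho J f k).
  rewrite mulrACA; apply: ler_pM; rewrite ?exprn_ge0 //.
  apply: le_trans H1 _; apply: ler_wpM2l; first by rewrite exprn_ge0.
  (* Detection excludes the weight-zero regime for the full set of rows: each [C] outside [Kx] is
     nonzero somewhere, so its term [0 ^+ weight] is 0. *)
  rewrite -[leRHS]addr0 lerD // [X in _ * X]big1 ?mulr0 // => C CK.
  have wC : (0 < weight [set: I]%SET C (shift x f k))%N.
    move/fintype.forallP: det => /(_ C); move: CK; rewrite !inE.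
    case: (C \in K) => //=; rewrite ?andbF //= andbT => Cx.
    by rewrite (_ : C != 0) //; apply: contra Cx => /eqP ->; rewrite ffunE.
  by rewrite expr0n eqn0Ngt wC.
apply: (@le_trans _ _ ((detected Kx f)%:R * Mx * \sum_k Bd (shift x f k))).
  by rewrite mulr_sumr; apply: ler_sum => k _; exact: pointwise.
rewrite -/Mx -[leRHS]mulrA [leRHS]mulrCA; apply: ler_wpM2l; first by rewrite mulr_ge0.
have expand g : Bd g = Amp N1 * Amp #|J| + Amp N1 * E2 * T2 g
  + Amp N1 * p%:R ^+ N2 * T3 g + Amp #|J| * E1 * T1 g
  + E1 * E2 * (T1 g * T2 g) + E1 * p%:R ^+ N2 * (T1 g * T3 g).
  by rewrite /Bd; ring.
under eq_bigr do rewrite expand.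
rewrite !big_split /= -!mulr_sumr sumr_const card_ffun card_ord.
have pb := @expr_product_le R p%:R kappa sigma^-1 (1 + p%:R * sigma ^+ L) m.
(* Here [r] rows are charged the trivial factor [p], and the exponents are bounded in terms of the
   other [q] rows. *)
have H q r e1 e2 e3 : #|I| = (r + q)%N -> (m <= q)%N -> (e1 <= q)%N ->
    (e2 <= 2 * q)%N -> (e3 <= q)%N ->
    p%:R ^+ r * ((p%:R * kappa) ^+ e1 * sigma^-1 ^+ e2 * (1 + p%:R * s) ^+ e3)
    <= p%:R ^+ #|I| * mu ^+ m.
  move=> -> mq le1 le2 le3; rewrite [X in _ <= X * _]exprD -[leRHS]mulrA; apply: ler_wpM2l.
    by rewrite exprn_ge0.
  exact: pb.
set Q := p%:R ^+ #|I| * mu ^+ m in H.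
have b2 : E2 * ((1 + p%:R * s) ^+ #|J| * p%:R ^+ #|~: J|) <= Q.
  apply: le_trans (H #|J| #|~: J| N2 #|J| #|J| _ _ _ _ _); rewrite ?nE ?JE ?N1E; try (clear; lia).
  by rewrite /E2 JE mulrA [leLHS]mulrC.
(* The left side is [p ^ (#|I| - m)]: the weight-zero regime gains exactly [p ^ -m], and
   [1 <= p * mu]. *)
have b3 : p%:R ^+ N2 * p%:R ^+ #|~: J| <= Q.
  apply: le_trans (H m (#|~: J| + N2)%N 0%N 0%N 0%N _ _ _ _ _); rewrite ?nE ?JE ?N1E; try (clear; lia).
  by rewrite !expr0 !mulr1 exprD mulrC.
have b1 : E1 * (1 + p%:R * s) ^+ #|I| <= Q.
  apply: le_trans (H #|I| 0%N N1 N1 #|I| _ _ _ _ _); rewrite ?nE ?JE ?N1E; try (clear; lia).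
  by rewrite /E1 N1E expr0 mul1r.
have b12 : E1 * E2 * ((1 + p%:R * s) ^+ #|~: J| * (1 + p%:R * s) ^+ #|J|) <= Q.
  apply: le_trans (H #|I| 0%N (N1 + N2)%N (N1 + #|J|)%N (#|~: J| + #|J|)%N _ _ _ _ _); rewrite ?nE ?JE ?N1E; try (clear; lia).
  by rewrite /E1 /E2 JE N1E !exprD expr0 mul1r; rewrite le_eqVlt; apply/orP; left; apply/eqP; ring.
have b13 : E1 * p%:R ^+ N2 * (1 + p%:R * s) ^+ #|~: J| <= Q.
  apply: le_trans (H (#|~: J| + m)%N N2 N1 N1 #|~: J| _ _ _ _ _); rewrite ?nE ?JE ?N1E; try (clear; lia).
  by rewrite /E1 N1E; rewrite le_eqVlt; apply/orP; left; apply/eqP; ring.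
have pull (e u : R) v w : 0 <= e -> u <= c * v -> e * v <= w -> e * u <= c * w.
  move=> e0 uv ew; apply: (@le_trans _ _ (e * (c * v))); first exact: ler_wpM2l.
  by rewrite mulrCA; apply: ler_wpM2l.
have B2 : Amp N1 * E2 * (\sum_(k : {ffun I -> 'I_p}) T2 (shift x f k)) <= Amp N1 * (c * Q).
  by rewrite -mulrA; apply: ler_wpM2l => //; apply: pull (sumT2 f) b2.
have B3 : Amp N1 * p%:R ^+ N2 * (\sum_(k : {ffun I -> 'I_p}) T3 (shift x f k)) <= Amp N1 * (c * Q).
  by rewrite -mulrA; apply: ler_wpM2l => //; apply: pull (sumT3 f) b3; rewrite exprn_ge0.
have B1 : Amp #|J| * E1 * (\sum_(k : {ffun I -> 'I_p}) T1 (shift x f k)) <= Amp #|J| * (c * Q).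
  by rewrite -mulrA; apply: ler_wpM2l => //; apply: pull (sumT1 f) b1.
have B12 : E1 * E2 * (\sum_(k : {ffun I -> 'I_p}) T1 (shift x f k) * T2 (shift x f k)) <= c * (c * Q).
  apply: (pull _ _ _ _ _ (sumT1T f s_ge0)); first by rewrite mulr_ge0.
  by apply: (pull _ _ _ _ _ (lexx _) b12); rewrite mulr_ge0.
have B13 : E1 * p%:R ^+ N2 * (\sum_(k : {ffun I -> 'I_p}) T1 (shift x f k) * T3 (shift x f k)) <= c * (c * Q).
  apply: (pull _ _ _ _ _ (sumT1T f (lexx 0))); first by rewrite mulr_ge0 ?exprn_ge0.
  apply: (pull _ _ _ _ _ (lexx _)); first by rewrite mulr_ge0 ?exprn_ge0.
  by rewrite mulr0 addr0 expr1n mulr1.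
rewrite -[_ *+ (_ ^ _)%N]mulr_natl natrX.
have -> : p%:R ^+ #|I| * (Amp N1 * Amp #|J| + (2%:R * #|K|%:R * Amp N1 +
   #|K|%:R * Amp #|J| + 2%:R * #|K|%:R * #|K|%:R) * mu ^+ m) =
   p%:R ^+ #|I| * (Amp N1 * Amp #|J|) + Amp N1 * (c * Q) + Amp N1 * (c * Q)
   + Amp #|J| * (c * Q) + c * (c * Q) + c * (c * Q).
  by rewrite /c /Q; ring.
apply: lerD; last exact: B13.
apply: lerD; last exact: B12.
apply: lerD; last exact: B1.
apply: lerD; last exact: B3.
apply: lerD; last exact: B2.
by rewrite mulrCA.
Qed.

End Step.
(** * Induction on the group of characters *)

Section Limit.
Variables (a : nat) (G : finZmodType) (R : realType).
Local Notation dual := {ffun G -> 'Z_a}.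

(** Take [y] with [C0 y != 0], the least [d > 0] such that [d] kills [C y] for every [C] in [K], and
    a prime divisor [p] of [d]; then [x = y *+ (d / p)]. Only the values [C x] need be killed by
    [p], not [x] itself. *)
Lemma prime_torsion_point (K : {set dual}) (C0 : dual) :
  K \subset characters a G -> C0 \in K -> C0 != 0 ->
  exists x p, [/\ prime p, {in K, forall C : dual, C x *+ p = 0} &
    exists2 C : dual, C \in K & C x != 0].
Proof.
move=> Kchar C0K C00.
have [y C0y] : exists y, C0 y != 0.
  apply/fintype.existsP; rewrite -[X in is_true X]negbK fintype.negb_exists.
  apply: contra C00 => /fintype.forallP H; apply/eqP/ffunP => y.
  by rewrite ffunE; apply/eqP; rewrite -[_ == _]negbK H.
pose Q d := (0 < d)%N && [forall C in K, C y *+ d == 0].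
have exQ : exists d, Q d.
  exists (Zp_trunc a).+2; rewrite /Q /=; apply/fintype.forallP => C; apply/implyP => _.
  by apply/eqP; rewrite Zp_mulrn; apply: val_inj; rewrite /= modnMl.
case: (ex_minnP exQ) => d /andP[d0 /fintype.forallP Qd] dmin.
have d1 : (1 < d)%N.
  rewrite ltn_neqAle d0 andbT; apply/eqP => d1.
  by have := Qd C0; rewrite C0K -d1 mulr1n (negPf C0y).
have p_pr := pdiv_prime d1; set p := pdiv d in p_pr.
have dE : (d = d %/ p * p)%N by rewrite divnK // pdiv_dvd.
exists (y *+ (d %/ p)), p; split=> // [C CK|].
  rewrite charactersMn ?(fintype.subsetP Kchar) // -mulrnA -dE.
  by apply/eqP; have := Qd C; rewrite CK.
have dp0 : (0 < d %/ p)%N by rewrite divn_gt0 ?prime_gt0 // dvdn_leq // pdiv_dvd.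
have : ~~ Q (d %/ p)%N.
  apply/negP => /dmin; rewrite leqNgt => /negP; apply.
  by rewrite ltn_Pdiv // prime_gt1.
rewrite /Q dp0 /= fintype.negb_forall => /fintype.existsP[C].
rewrite negb_imply => /andP[CK Cy]; exists C => //.
by rewrite charactersMn // (fintype.subsetP Kchar).
Qed.

Lemma sub_zmod_closed (K : {set dual}) x :
  zmod_closed K -> zmod_closed [set C in K | C x == 0]%SET.
Proof.
move=> [K0 KB]; split=> [|C D]; rewrite !inE ?K0 ?ffunE ?eqxx //.
by move=> /andP[CK /eqP Cx] /andP[DK /eqP Dx]; rewrite KB //= Cx Dx subrr.
Qed.

Local Notation rows n alpha := [set i : 'I_n | (alpha <= i)%N]%SET.

Lemma card_rows n alpha : (alpha <= n)%N -> #|rows n alpha| = (n - alpha)%N.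
Proof.
move=> _; rewrite -sum1_card; under eq_bigl do rewrite inE.
have := big_geq_mkord alpha n xpredT (fun=> 1%N) : _ = \sum_(i < n | _) _.
by rewrite sum_nat_const_nat muln1 => ->.
Qed.

Definition weighted_count (rho : R) (K : {set dual}) (n alpha beta : nat) : R :=
  \sum_(f : {ffun 'I_n -> G}) (detected K f)%:R *
    (mass rho K [set: 'I_n]%SET f ^+ (n - beta) *
     mass rho K (rows n alpha) f ^+ beta).

(** Induction on [#|K|], from [Kx] to [K]. It suffices that [n - alpha - beta] is large, since it
    bounds both thresholds [n - beta] and [n - alpha] from below. *)
Lemma weighted_count_limit (rho : R) (K : {set dual}) :
  0 <= rho < 1 -> K \subset characters a G -> zmod_closed K ->
  forall d : R, 0 < d -> exists m0, forall n alpha beta : nat,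
    (alpha + beta + m0 <= n)%N ->
    weighted_count rho K n alpha beta <= (1 + d) * #|G|%:R ^+ n.
Proof.
move=> rho01.
have [k leK] := ubnP #|K|; elim: k => // k IH in K leK *.
move=> Kchar Kz d d0; have [r0 r1] := andP rho01.
have [/fintype.existsP[C0 /andP[C0K C00]]|K1] := boolP [exists C in K, C != 0]; last first.
  (* For [K = 0] all masses are 1, so the count is exactly [#|G| ^ n]. *)
  exists 0%N => n alpha beta _.
  have -> : weighted_count rho K n alpha beta = #|G|%:R ^+ n.
    have KE : K = [set (0 : dual)]%SET.
      apply/finset.setP => C; rewrite !inE; apply/idP/eqP => [CK|->]; last by case: Kz.
      apply/eqP; move: K1; rewrite fintype.negb_exists => /fintype.forallP/(_ C).
      by rewrite CK negbK.
    rewrite /weighted_count -natrX -[in RHS](card_ord n) -card_ffun -sumr_const.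
    apply: eq_bigr => f _.
    have m1 J : mass rho K J f = 1 by rewrite KE /mass big_set1 weight0 expr0.
    rewrite !m1 !expr1n !mulr1 (_ : detected K f) //.
    by apply/fintype.forallP => C; rewrite KE inE; case: eqVneq.
  by rewrite ler_peMl ?exprn_ge0 // lerDl ltW.
have [x [p [p_pr Kp [C1 C1K C1x]]]] := prime_torsion_point Kchar C0K C00.
pose Kx := [set C in K | C x == 0]%SET.
have KxK : (#|Kx| < #|K|)%N.
  apply: proper_card; apply/properP; split; last by exists C1; rewrite // inE C1K.
  by apply/fintype.subsetP => C; rewrite inE => /andP[].
have sKx : Kx \subset characters a G.
  apply/fintype.subsetP => C; rewrite inE => /andP[+ _]; exact: (fintype.subsetP Kchar).
pose kappa := contraction K p rho.
have [k0 k1] := andP (contraction_bounds Kz p_pr rho01 : 1 / 2%:R <= kappa < 1).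
(* As [kappa < 1], the inequality of means gives [kappa < sigma ^ 2]; this leaves room for the
   factor [1 + p * sigma ^+ L] once [L] is large, so that [mu < 1]. *)
pose sigma := (1 + kappa) / 2%:R.
have sigma01 : 0 < sigma < 1 by rewrite /sigma; clear -k0 k1; apply/andP; split; lra.
have [s0 s1] := andP sigma01.
have ks : kappa < sigma * sigma by rewrite /sigma; clear -k0 k1; nra.
have ss0 : 0 < sigma * sigma by rewrite mulr_gt0.
pose nu := kappa / (sigma * sigma).
have nu1 : nu < 1 by rewrite ltr_pdivrMr // mul1r.
have nu0 : 0 < nu by rewrite divr_gt0 //; clear -k0; lra.
have p0 : 0 < p%:R :> R by rewrite ltr0n prime_gt0.
have [L0 HL0] : exists L0, forall m, (L0 <= m)%N -> sigma ^+ m <= (1 - nu) / (2%:R * p%:R).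
  by apply: expr_small; rewrite ?ltW // divr_gt0 ?subr_gt0 // mulr_gt0.
pose L := L0.+1; pose mu := kappa * (1 + p%:R * sigma ^+ L) * sigma^-1 ^+ 2.
have muE : mu = nu * (1 + p%:R * sigma ^+ L).
  by rewrite /mu /nu; field; rewrite lt0r_neq0.
have pL : p%:R * sigma ^+ L <= (1 - nu) / 2%:R.
  have := HL0 L (leqnSn _); rewrite ler_pdivlMr ?mulr_gt0 // => H.
  by rewrite ler_pdivlMr // mulrC mulrA mulrC.
have mu0 : 0 <= mu.
  rewrite muE; apply: mulr_ge0; first exact: ltW.
  by apply: addr_ge0 => //; apply: mulr_ge0; rewrite ?exprn_ge0 // ltW.
have mu1 : mu < 1.
  apply: (@le_lt_trans _ _ (nu * (1 + (1 - nu) / 2%:R))).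
    by rewrite muE; apply: ler_wpM2l; [exact: ltW|rewrite lerD2l].
  by clear -nu0 nu1; nra.
pose c : R := #|K|%:R.
have c0 : 0 <= c by [].
(* The constant comes from [(1 + 4 e) (1 + e) <= 1 + 9 e] for [e <= 1]. *)
pose e := Num.min 1 (d / 9%:R).
have e0 : 0 < e by rewrite lt_min ltr01 divr_gt0.
have e1 : e <= 1 by rewrite ge_min lexx.
have e8 : e <= d / 9%:R by rewrite ge_min lexx orbT.
have [m1 Hm1] := @expr1D_expr_limit R rho c e L rho01 c0 isT e0.
(* The amplifications are at most [1 + e <= 2], so the coefficient of [mu ^+ m] is at most
   [6 c + 2 c ^ 2]; adding 1 makes it a positive divisor. *)
have w0 : 0 < 6%:R * c + 2%:R * c * c + 1 by rewrite ltr_wpDl // addr_ge0 ?mulr_ge0.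
have [m2 Hm2] : exists m2, forall m, (m2 <= m)%N ->
    mu ^+ m <= e / (6%:R * c + 2%:R * c * c + 1).
  by apply: expr_small; rewrite ?mu0 ?mu1 // divr_gt0.
have [m3 Hm3] := IH Kx (leq_trans KxK leK) sKx (sub_zmod_closed x Kz) e e0.
exists (m1 + m2 + m3)%N => n alpha beta nab.
pose m := (n - alpha - beta)%N.
have mE : (alpha + beta + m = n)%N by rewrite /m; move: nab; clear; lia.
pose J := rows n alpha.
have cJ : #|J| = (beta + m)%N by rewrite card_rows /m; move: nab; clear; lia.
have cJC : #|~: J| = alpha.
  by have := cardsC J; rewrite cJ card_ord; move: mE; clear; lia.
have pn0 : 0 < p%:R ^+ n :> R by rewrite exprn_gt0.
rewrite -(ler_pM2l pn0).
pose Phi (f : {ffun 'I_n -> G}) : R := (detected K f)%:R *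
  (mass rho K [set: 'I_n]%SET f ^+ (n - beta) * mass rho K J f ^+ beta).
have := sum_shift p x Phi; rewrite card_ord => sumE.
rewrite -[weighted_count _ K _ _ _]/(\sum_f Phi f) sumE {sumE}.
have N1E : (n - beta = #|~: J| + m)%N by rewrite cJC /m; move: nab; clear; lia.
have sg : 0 < sigma <= 1 by rewrite s0 ltW.
have mul1 : mu <= 1 by exact: ltW.
have step f := sum_shift_mass Kchar Kz p_pr Kp rho01 sg (isT : (0 < L)%N) mul1 N1E cJ f.
(* Bounds [(1 + e) ^ 2 + e], the last [e] being the share of [mu ^+ m]. *)
pose X : R := 1 + 4%:R * e.
have amp0 N : 0 <= (1 + c * rho ^+ (N %/ L)) ^+ N.
  by rewrite exprn_ge0 // addr_ge0 // mulr_ge0 // exprn_ge0.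
have ampN1 : (1 + c * rho ^+ ((n - beta) %/ L)) ^+ (n - beta) <= 1 + e.
  by apply: Hm1; move: nab; clear; lia.
have ampJ : (1 + c * rho ^+ (#|J| %/ L)) ^+ #|J| <= 1 + e.
  by apply: Hm1; rewrite cJ /m; move: nab; clear; lia.
have mum : (6%:R * c + 2%:R * c * c + 1) * mu ^+ m <= e.
  by rewrite mulrC -ler_pdivlMr // Hm2 // /m; move: nab; clear; lia.
have {}step f : \sum_(k : {ffun 'I_n -> 'I_p}) (detected K (shift x f k))%:R *
     (mass rho K [set: 'I_n]%SET (shift x f k) ^+ (n - beta) *
      mass rho K J (shift x f k) ^+ beta)
   <= p%:R ^+ n * ((detected Kx f)%:R *
     (mass rho Kx [set: 'I_n]%SET f ^+ (n - beta) * mass rho Kx J f ^+ beta)) * X.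
  apply: le_trans (step f) _; rewrite card_ord; apply: ler_wpM2l.
    apply: mulr_ge0; first exact: ltW.
    apply: mulr_ge0 => //.
    by apply: mulr_ge0; apply: exprn_ge0; apply: sumr_ge0 => C _; rewrite exprn_ge0.
  have mum0 : 0 <= mu ^+ m by rewrite exprn_ge0.
  rewrite -/c; move: (amp0 (n - beta)%N) (amp0 #|J|) ampN1 ampJ mum mum0.
  set A1 := (1 + _) ^+ (n - beta); set A2 := (1 + _) ^+ #|J|; set M := mu ^+ m.
  move=> A10 A20 A1e A2e Me M0; rewrite /X.
  have AA : A1 * A2 <= (1 + e) * (1 + e) by rewrite ler_pM.
  have ee : e * e <= e by rewrite ler_piMl // ltW.
  have coef : 2%:R * c * A1 + c * A2 + 2%:R * c * c <= 6%:R * c + 2%:R * c * c + 1.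
    have : c * A1 <= c * 2%:R.
      by apply: ler_wpM2l => //; apply: (le_trans A1e); rewrite lerD2l.
    have : c * A2 <= c * 2%:R.
      by apply: ler_wpM2l => //; apply: (le_trans A2e); rewrite lerD2l.
    clear; lra.
  have := le_trans (ler_wpM2r M0 coef) Me.
  move: AA ee; clear; set Y := (_ + _) * M; lra.
apply: (@le_trans _ _ (p%:R ^+ n * X * weighted_count rho Kx n alpha beta)).
  rewrite /weighted_count mulr_sumr; apply: ler_sum => f _.
  by apply: le_trans (step f) _; rewrite mulrAC.
have X0 : 0 <= X by rewrite addr_ge0 // mulr_ge0 // ltW.
rewrite -mulrA; apply: ler_wpM2l; first exact: ltW.
apply: (@le_trans _ _ (X * ((1 + e) * #|G|%:R ^+ n))).
  by apply: ler_wpM2l => //; apply: Hm3; move: nab; clear; lia.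
rewrite mulrA; apply: ler_wpM2r; first by rewrite exprn_ge0.
have ee : e * e <= e by rewrite ler_piMl // ltW.
by rewrite /X; move: e8 ee; clear; lra.
Qed.

End Limit.
(** * Fourier analysis *)

(** [X ^ n - 1] is separable and splits, so it has [n] distinct roots, among which one is
    primitive. *)
Lemma closed_prim_root_exists (F : numClosedFieldType) n :
  (0 < n)%N -> {z : F | n.-primitive_root z}.
Proof.
pose p : {poly F} := 'X^n - 1; have [r Dp] := closed_field_poly_normal p.
move=> n_gt0; apply/sigW; rewrite (monicP _) ?monicXnsubC // scale1r in Dp.
have rn1 : all n.-unity_root r by apply/allP=> z; rewrite -root_prod_XsubC -Dp.
have sz_r : (n < (size r).+1)%N.
  by rewrite -(size_prod_XsubC r id) -Dp size_XnsubC.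
have [|z] := hasP (has_prim_root n_gt0 rn1 _ sz_r); last by exists z.
rewrite -separable.separable_prod_XsubC -Dp.
by rewrite cyclotomic.separable_Xn_sub_1 // pnatr_eq0 -lt0n.
Qed.

(** The irreducible complex characters of an abelian group are linear with trivial common kernel;
    taking logarithms to the base of a primitive root makes them ['Z_a]-valued. *)
Lemma characters_separate (a : nat) (G : finZmodType) (g : G) :
  (exponent [set: G]%SET %| (Zp_trunc a).+2)%N -> g != 0 ->
  exists2 C, C \in characters a G & C g != 0.
Proof.
move=> expG g0; set N := (Zp_trunc a).+2 in expG.
have abG : abelian [set: G]%G by exact: FinRing.zmod_abelian.
have [i gi] : exists i : Iirr [set: G]%G, g \notin cfker 'chi_i.
  apply/fintype.existsP; rewrite -[X in is_true X]negbK fintype.negb_exists.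
  apply: contra g0 => /fintype.forallP H.
  have : g \in (\bigcap_i cfker 'chi[[set: G]%G]_i)%SET.
    by apply/finset.bigcapP => i _; rewrite -[_ \in _]negbK H.
  by rewrite TI_cfker_irr inE.
have lin := char_abelianP _ abG i.
have [z zP] := cyclotomic.C_prim_root_exists (ltn0Sn (Zp_trunc a).+1).
have chiN x : 'chi_i x ^+ N = 1.
  by rewrite -lin_charX ?inE // (exponentP expG) ?inE // lin_char1.
pose k x : 'Z_a := sval (prim_rootP zP (chiN x)).
have kE x : 'chi_i x = z ^+ k x by exact: (svalP (prim_rootP zP (chiN x))).
exists [ffun x => k x]; last first.
  rewrite ffunE; apply: contra gi => /eqP k0.
  by rewrite cfkerEchar ?irr_char // !inE /= lin_char1 // kE k0.
rewrite inE; apply/fintype.forallP => x; apply/fintype.forallP => y.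
rewrite !ffunE -val_eqE /=.
have : z ^+ k (x + y) == z ^+ (k x + k y).
  by rewrite exprD -!kE -lin_charM ?inE.
by rewrite (eq_prim_root_expr zP) [X in X == _]modn_small.
Qed.

(** * Roots of unity and orthogonality of characters *)

Section RootOfUnity.
Variables (a : nat) (F : numClosedFieldType) (z : F).
Hypothesis z_prim : (Zp_trunc a).+2.-primitive_root z.

Definition unity_char (c : 'Z_a) : F := z ^+ c.
Local Notation chi := unity_char.

Lemma unity_char0 : chi 0 = 1.
Proof. exact: expr0. Qed.

Lemma unity_charD c d : chi (c + d) = chi c * chi d.
Proof. by rewrite /chi /= (prim_expr_mod z_prim) exprD. Qed.

Lemma unity_char_eq1 c : (chi c == 1) = (c == 0).
Proof.
rewrite /chi -(prim_order_dvd z_prim) -val_eqE /=.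
have [->|c0] := posnP c; first by rewrite dvdn0.
by rewrite gtnNdvd // ?gtn_eqF // ltn_ord.
Qed.

Lemma unity_char_norm c : `|chi c| = 1.
Proof.
rewrite normrX; apply/eqP.
have : `|z| ^+ (Zp_trunc a).+2 == 1 by rewrite -normrX (prim_expr_order z_prim) normr1.
by rewrite pexpr_eq1 // => /eqP ->; rewrite expr1n.
Qed.

Lemma unity_char_sum (I : finType) (c : I -> 'Z_a) :
  chi (\sum_i c i) = \prod_i chi (c i).
Proof. exact: (big_morph chi unity_charD unity_char0). Qed.

Lemma unity_char_sum_norm c d : `|chi c + chi d| = `|1 + chi (d - c)|.
Proof.
have -> : chi c + chi d = chi c * (1 + chi (d - c)).
  by rewrite mulrDr mulr1 -unity_charD [c + _]addrC subrK.
by rewrite normrM unity_char_norm mul1r.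
Qed.

(** Equality in the triangle inequality would force [chi c = 1]. *)
Lemma unity_char_norm_lt2 c : c != 0 -> `|1 + chi c| < 2%:R.
Proof.
move=> c0; rewrite lt_neqAle; apply/andP; split; last first.
  by apply: le_trans (ler_normD _ _) _; rewrite normr1 unity_char_norm.
apply: contra c0 => /eqP E.
have := @normCDeq F 1 (chi c); rewrite normr1 unity_char_norm => /(_ E)[t _ [E1 E2]].
by rewrite -unity_char_eq1 E2 -E1.
Qed.

Section Orthogonality.
Variable G : finZmodType.
Hypothesis expG : (exponent [set: G]%SET %| (Zp_trunc a).+2)%N.
Local Notation dual := {ffun G -> 'Z_a}.

(** Translating the sum by a character that separates [g] from 0 multiplies it by a factor other
    than 1. *)
Lemma sum_characters_at (g : G) :
  \sum_(C in characters a G) chi (C g) = #|characters a G|%:R *+ (g == 0).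
Proof.
have [->|g0] := eqVneq g 0.
  rewrite -sumr_const; apply: eq_bigr => C CP.
  by rewrite characters0 // unity_char0.
have [C0 C0P C0g] := characters_separate expG g0.
rewrite mulr0n; set S := LHS.
have : S = chi (C0 g) * S.
  rewrite /S mulr_sumr (reindex_inj (addrI C0)) /=; apply: eq_big => [C|C _].
    have [_ KB] := characters_zmod_closed a G.
    have [K0 _] := characters_zmod_closed a G.
    apply/idP/idP => CP; first by rewrite -(addKr C0 C) addrC KB.
    by rewrite -[C0]opprK addrC KB // -sub0r KB.
  by rewrite ffunE unity_charD.
move/eqP; rewrite -subr_eq0 -{1}[S]mul1r -mulrBl mulf_eq0 subr_eq0 eq_sym.
by rewrite unity_char_eq1 (negPf C0g) => /eqP.
Qed.

Lemma sum_character (C : dual) :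
  C \in characters a G -> \sum_g chi (C g) = #|G|%:R *+ (C == 0).
Proof.
move=> CP; have [->|C0] := eqVneq C 0.
  rewrite -sumr_const; apply: eq_bigr => g _.
  by rewrite ffunE unity_char0.
have [x Cx] : exists x, C x != 0.
  apply/fintype.existsP; rewrite -[X in is_true X]negbK fintype.negb_exists.
  apply: contra C0 => /fintype.forallP H; apply/eqP/ffunP => y.
  by rewrite ffunE; apply/eqP; rewrite -[_ == _]negbK H.
rewrite mulr0n; set S := LHS.
have : S = chi (C x) * S.
  rewrite /S mulr_sumr (reindex_inj (addrI x)) /=; apply: eq_bigr => g _.
  by rewrite charactersD // unity_charD.
move/eqP; rewrite -subr_eq0 -{1}[S]mul1r -mulrBl mulf_eq0 subr_eq0 eq_sym.
by rewrite unity_char_eq1 (negPf Cx) => /eqP.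
Qed.

(** The two orthogonality relations evaluate the same double sum. *)
Lemma card_characters : #|characters a G| = #|G|.
Proof.
apply/eqP; rewrite -(eqr_nat F); apply/eqP.
transitivity (\sum_(g : G) \sum_(C in characters a G) chi (C g)).
  rewrite (bigD1 0) //= [X in _ + X]big1 => [|g g0]; first by rewrite sum_characters_at eqxx addr0.
  by rewrite sum_characters_at (negPf g0).
have [K0 _] := characters_zmod_closed a G.
rewrite exchange_big /= (bigD1 _ K0) /= [X in _ + X]big1 => [|C /andP[CP C0]].
  by rewrite sum_character // eqxx addr0.
by rewrite sum_character // (negPf C0).
Qed.

End Orthogonality.
End RootOfUnity.

(** * Characteristic functions of entries and columns *)

Section Fourier.
Variables (a : nat) (R : realType).
Local Notation F := (R[i])%C.
Variable z : F.
Hypothesis z_prim : (Zp_trunc a).+2.-primitive_root z.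
Local Notation chi := (unity_char z).
Local Notation toC := (real_complex R).

Definition charfun (w : 'Z_a -> R) (c : 'Z_a) : F := \sum_x toC (w x) * chi (c * x).

Lemma norm_real_complex (x : R) : `|toC x| = toC `|x|.
Proof. by rewrite normc_def /= expr0n addr0 sqrtr_sqr. Qed.

(** Twice the characteristic function is the average of [chi (c * x) + chi (c * y)] over independent
    [x], [y]. The norm of this sum is below 2 by a fixed amount unless [c * (y - x) = 0], which for
    fixed [x] has probability at most [1 - eps]. The resulting [rho] depends on neither [w] nor
    [c]. *)
Lemma charfun_contract (eps : R) : 0 < eps < 1 ->
  exists2 rho : R, 0 <= rho < 1 &
  forall (w : 'Z_a -> R) (c : 'Z_a),
    (forall x, 0 <= w x) -> \sum_x w x = 1 ->
    (forall r, \sum_(x | c * (x - r) == 0) w x <= 1 - eps) ->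
    `|charfun w c| <= toC rho.
Proof.
move=> /andP[eps0 eps1].
pose len (c : 'Z_a) : R := complex.Re `|1 + chi c|.
have lenE c : `|1 + chi c| = toC (len c) by rewrite /len normc_def.
(* A maximum over finitely many residues, hence still below 2; the default 0 gives [0 <= M]. *)
pose M : R := \big[Num.max/0]_(c | c != 0) len c.
have M2 : M < 2%:R.
  apply: bigmax_lt => // c c0; rewrite -ltcR -lenE rmorph_nat.
  exact: unity_char_norm_lt2.
have M0 : 0 <= M by exact: bigmax_ge_id.
exists (1 - (1 - M / 2%:R) * eps); first by apply/andP; split; nra.
move=> w c w0 w1 wc.
have two : `|charfun w c| * 2%:R <=
    toC (\sum_x \sum_y w x * w y * (if c * (y - x) == 0 then 2%:R else M)).
  have -> : `|charfun w c| * 2%:R =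
      `|\sum_x \sum_y toC (w x * w y) * (chi (c * x) + chi (c * y))|.
    rewrite -[2%:R in LHS]normr_nat -normrM; congr (`| _ |).
    rewrite mulr_natr mulr2n.
    have E (u : 'Z_a -> F) : \sum_x \sum_y toC (w x * w y) * u x = \sum_x toC (w x) * u x.
      apply: eq_bigr => x _; under eq_bigr do rewrite rmorphM /= mulrAC.
      by rewrite -mulr_sumr -rmorph_sum /= w1 rmorph1 mulr1.
    rewrite {1}/charfun -E /charfun -E [X in _ + X]exchange_big /= -big_split /=.
    apply: eq_bigr => x _; rewrite -big_split /=; apply: eq_bigr => y _.
    by rewrite [w y * w x]mulrC mulrDr.
  apply: le_trans (ler_norm_sum _ _ _) _; rewrite rmorph_sum /=; apply: ler_sum => x _.
  apply: le_trans (ler_norm_sum _ _ _) _; rewrite rmorph_sum /=; apply: ler_sum => y _.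
  rewrite normrM norm_real_complex (ger0_norm (mulr_ge0 (w0 x) (w0 y))).
  rewrite [X in _ <= X]rmorphM /=.
  apply: ler_wpM2l; first by rewrite ler0c mulr_ge0.
  rewrite (unity_char_sum_norm z_prim) -mulrBr lenE lecR.
  have [->|cyx] := eqVneq (c * (y - x)) 0.
    by rewrite -lecR -lenE unity_char0 rmorph_nat -[1 + 1]/(2%:R) normr_nat.
  exact: (le_bigmax_cond 0 len cyx).
have bnd : \sum_x \sum_y w x * w y * (if c * (y - x) == 0 then 2%:R else M) <=
    2%:R - (2%:R - M) * eps.
  have -> : 2%:R - (2%:R - M) * eps = \sum_x w x * (2%:R - (2%:R - M) * eps).
    by rewrite -mulr_suml w1 mul1r.
  apply: ler_sum => x _.
  have -> : \sum_y w x * w y * (if c * (y - x) == 0 then 2%:R else M) =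
     w x * (M + (2%:R - M) * \sum_(y | c * (y - x) == 0) w y).
    rewrite mulrDr -{2}[M]mulr1 -w1 !mulr_sumr [X in _ + X]big_mkcond -big_split /=.
    apply: eq_bigr => y _; case: ifP => _; ring.
  apply: ler_wpM2l => //.
  have := ler_wpM2l (_ : 0 <= 2%:R - M) (wc x); rewrite subr_ge0 ltW // => /(_ isT).
  by move: eps0; clear; set s := \sum_(_ | _) _; lra.
rewrite -(ler_pM2r (_ : 0 < 2%:R :> F)) //; apply: le_trans two _.
rewrite -(rmorph_nat (real_complex R)) -rmorphM lecR.
by apply: le_trans bnd _; move: M2 eps0; clear; lra.
Qed.

Lemma charfun0 w : \sum_x w x = 1 -> charfun w 0 = 1.
Proof.
move=> w1; rewrite /charfun; under eq_bigr do rewrite mul0r unity_char0 mulr1.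
by rewrite -rmorph_sum /= w1.
Qed.

Lemma charfun_le1 w c : (forall x, 0 <= w x) -> \sum_x w x = 1 -> `|charfun w c| <= 1.
Proof.
move=> w0 w1; apply: le_trans (ler_norm_sum _ _ _) _.
have -> : 1 = \sum_x toC (w x) by rewrite -rmorph_sum /= w1.
apply: ler_sum => x _.
by rewrite normrM (unity_char_norm z_prim) mulr1 norm_real_complex ger0_norm.
Qed.

Variable G : finZmodType.
Hypothesis expG : (exponent [set: G]%SET %| (Zp_trunc a).+2)%N.
Local Notation Gamma := (characters a G).

(** Fourier inversion turns the scaled probability into a sum over characters of products of
    characteristic functions. The zero character gives 1, and the others are bounded row by row, by
    [rho] or by 1. *)
Lemma column_bound (I : finType) (J : {set I}) (rho : R) (w : I -> 'Z_a -> R)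
    (f : I -> G) :
  0 <= rho <= 1 ->
  (forall i x, 0 <= w i x) -> (forall i, \sum_x w i x = 1) ->
  (forall i c, i \in J -> c != 0 -> `|charfun (w i) c| <= toC rho) ->
  `| #|G|%:R * (\sum_(v : {ffun I -> 'Z_a} | \sum_i f i *+ v i == 0)
        \prod_i w i (v i)) - 1| <= mass rho Gamma J f - 1.
Proof.
move=> /andP[rho0 rho1] w0 w1 wJ.
have [K0 _] := characters_zmod_closed a G.
have E : toC (#|G|%:R * \sum_(v : {ffun I -> 'Z_a} | \sum_i f i *+ v i == 0)
        \prod_i w i (v i)) = \sum_(C in Gamma) \prod_i charfun (w i) (C (f i)).
  rewrite rmorphM /= rmorph_nat rmorph_sum /= mulr_sumr.
  transitivity (\sum_(v : {ffun I -> 'Z_a})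
     \sum_(C in Gamma) toC (\prod_i w i (v i)) * chi (C (\sum_i f i *+ v i))).
    rewrite big_mkcond /=; apply: eq_bigr => v _; rewrite -mulr_sumr.
    rewrite (sum_characters_at z_prim expG) (card_characters z_prim expG).
    by case: ifP; rewrite ?mulr0 // mulrC.
  rewrite exchange_big /=; apply: eq_bigr => C CP.
  rewrite bigA_distr_bigA; apply: eq_bigr => v _.
  rewrite characters_sum // (unity_char_sum z_prim) rmorph_prod /= -big_split /=.
  apply: eq_bigr => i _; rewrite charactersMn //.
  by congr (_ * chi _); rewrite -mulr_natr natr_Zp.
rewrite -lecR -norm_real_complex rmorphB /= E rmorph1.
rewrite (bigD1 _ K0) /= big1 => [|i _]; last by rewrite ffunE charfun0.
rewrite addrAC subrr add0r /mass (bigD1 _ K0) /= weight0 expr0.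
rewrite [1 + _ - 1]addrAC subrr add0r rmorph_sum /=.
apply: le_trans (ler_norm_sum _ _ _) _; apply: ler_sum => C _.
rewrite normr_prod expr_weight rmorph_prod /=; apply: ler_prod => i _.
rewrite normr_ge0 /=; case: ifP => [/andP[iJ Ci]|_]; first exact: wJ.
by rewrite rmorph1 charfun_le1.
Qed.

End Fourier.
(** * The law of the random matrix *)

Lemma maximal_ideal_containing (A : finComNzRingType) (I : {set A}) :
  idealr_closed I -> exists2 J : {set A}, maximal_ideal J & I \subset J.
Proof.
move=> idI.
have [|J /maxsetP[/asboolP idJ maxJ] IJ] :=
  @maxset_exists A (fun J : {set A} => `[< idealr_closed J >]) I.
  exact/asboolP.
exists J => //; split=> // K idK JK; apply: maxJ => //; exact/asboolP.
Qed.

(** The annihilator of [c] is a proper ideal. Thus balancedness modulo maximal ideals controls the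
    event [c * (xi - r) = 0] for every nonzero [c]. *)
Lemma maximal_ideal_annihilator (A : finComNzRingType) (c : A) : c != 0 ->
  exists2 J : {set A}, maximal_ideal J & forall x, c * x = 0 -> x \in J.
Proof.
move=> c0.
have [|J maxJ sJ] := @maximal_ideal_containing A [set x | c * x == 0]%SET.
  split; rewrite ?inE ?mulr0 ?mulr1 // => b u v; rewrite !inE => /eqP cu /eqP cv.
  by rewrite mulrDr mulrCA cu mulr0 cv addr0.
exists J => // x cx; apply: (fintype.subsetP sJ).
by rewrite inE cx.
Qed.

Section FiniteProbability.
Context (d : measure_display) (Omega : measurableType d) (R : realType).
Variable P : probability Omega R.

Lemma fin_law_seq (T : finType) (X : Omega -> T) (s : seq T) :
  fin_random_variable X -> uniq s ->
  measurable [set w | X w \in s] /\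
  P [set w | X w \in s] = (\sum_(t <- s) P [set w | X w = t])%E.
Proof.
move=> mX; elim: s => [|t s IH] /=.
  rewrite big_nil (_ : [set w | _] = set0) ?measure0 //.
  by apply/seteqP; split => w.
move=> /andP[ts /IH[ms Ps]].
have -> : [set w | X w \in t :: s] = [set w | X w = t] `|` [set w | X w \in s].
  apply/seteqP; split => w /=; rewrite in_cons.
    by case/orP => [/eqP|]; [left|right].
  by case=> [->|->]; rewrite ?eqxx ?orbT.
split; first exact: measurableU.
rewrite measureU //; first by rewrite big_cons -Ps.
by apply/seteqP; split => w //= [-> ]; rewrite (negPf ts).
Qed.

Lemma fin_law (T : finType) (X : Omega -> T) (Q : pred T) :
  fin_random_variable X ->
  measurable [set w | Q (X w)] /\
  P [set w | Q (X w)] = (\sum_(t | Q t) P [set w | X w = t])%E.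
Proof.
move=> mX; have := fin_law_seq mX (enum_uniq Q).
rewrite (_ : [set w | X w \in enum Q] = [set w | Q (X w)]) ?big_enum //.
by apply/seteqP; split => w /=; rewrite mem_enum.
Qed.

(** Linearity of expectation for a sum of indicators. *)
Lemma expectation_card (T U : finType) (X : Omega -> T) (S : {set U}) (Q : U -> pred T) :
  fin_random_variable X ->
  ('E_P[fun w => #|[set u in S | Q u (X w)]%SET|%:R] =
   \sum_(u in S) P [set w | Q u (X w)])%E.
Proof.
move=> mX; rewrite unlock.
have mQ u : measurable [set w | Q u (X w)] by have [] := fin_law (Q u) mX.
transitivity (\int[P]_w (\sum_(u <- enum S) (\1_[set w | Q u (X w)] w)%:E))%E.
  apply: eq_integral => w _; rewrite sumEFin; congr (_%:E).
  rewrite big_enum /= -sum1_card natr_sum.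
  under eq_bigl do rewrite inE.
  rewrite big_mkcondr /=; apply: eq_bigr => u _.
  by rewrite indicE; case: ifPn => Qu; [rewrite mem_set | rewrite memNset //; exact/negP].
rewrite ge0_integral_sum //.
- rewrite big_enum /=; apply: eq_bigr => u _.
  by rewrite integral_indic // setIT.
- by move=> u; apply/measurable_realfun.measurable_EFinP; exact: measurable_realfun.measurable_indic.
Qed.

(** * Law of a matrix with a zero block *)

Section MatrixLaw.
Variables (a n alpha beta : nat) (eps : R) (M : Omega -> 'M['Z_a]_n).
Hypothesis mM : forall i j, fin_random_variable (fun w => M w i j).
Hypothesis M0 : forall i j : 'I_n, (i < alpha)%N -> (j < beta)%N ->
  forall w, M w i j = 0.
Hypothesis Mind : independent_on P (free_entries n alpha beta)
  (fun (ij : 'I_n * 'I_n) w => M w ij.1 ij.2).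
Hypothesis Mbal : forall ij, ij \in free_entries n alpha beta ->
  balanced P eps (fun w => M w ij.1 ij.2).

Definition entry_law (i j : 'I_n) (x : 'Z_a) : R := fine (P [set w | M w i j = x]).

Lemma entry_lawE i j x : P [set w | M w i j = x] = (entry_law i j x)%:E.
Proof. by rewrite fineK // fin_num_measure //; exact: mM. Qed.

Lemma entry_law_ge0 i j x : 0 <= entry_law i j x.
Proof. by rewrite fine_ge0. Qed.

Lemma entry_law_sum i j (Q : pred 'Z_a) :
  P [set w | Q (M w i j)] = (\sum_(x | Q x) entry_law i j x)%:E.
Proof.
have [_ ->] := fin_law Q (mM i j).
by rewrite -sumEFin; apply: eq_bigr => x _; rewrite entry_lawE.
Qed.

Lemma entry_law_sum1 i j : \sum_x entry_law i j x = 1.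
Proof.
apply: EFin_inj; rewrite -(entry_law_sum i j xpredT) -(probability_setT P).
by congr (P _); apply/seteqP; split.
Qed.

Lemma entry_law_balanced i j (c r : 'Z_a) :
  (i, j) \in free_entries n alpha beta -> c != 0 ->
  \sum_(x | c * (x - r) == 0) entry_law i j x <= 1 - eps.
Proof.
move=> ijD c0; have [I maxI annI] := maximal_ideal_annihilator c0.
rewrite -lee_fin -entry_law_sum; apply: le_trans (Mbal ijD maxI r).
apply: le_measure; rewrite ?inE.
- by have [] := fin_law (fun x => c * (x - r) == 0) (mM i j).
- by have [] := fin_law (fun x => x - r \in I) (mM i j).
- by move=> w /= /eqP /annI.
Qed.

Lemma fin_random_matrix : fin_random_variable M.
Proof.
move=> A.
have -> : [set w | M w = A] = \bigcap_(ij in [set: 'I_n * 'I_n]) [set w | M w ij.1 ij.2 = A ij.1 ij.2].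
  apply/seteqP; split => [w /= Mw ij _ /=|w H]; first by rewrite Mw.
  by apply/matrixP => i j; exact: (H (i, j)).
apply: fin_bigcap_measurable => //.
by move=> ij _; exact: mM.
Qed.

(** Independence covers the free entries only. A block entry is constantly 0, so its factor is 1 if
    [A] vanishes there; otherwise both sides are 0. *)
Lemma matrix_law (A : 'M['Z_a]_n) :
  P [set w | M w = A] = (\prod_i \prod_j entry_law i j (A i j))%:E.
Proof.
rewrite pair_bigA /=.
have [block|] := boolP [forall i : 'I_n, forall j : 'I_n,
    (i < alpha)%N && (j < beta)%N ==> (A i j == 0)].
  have {}block (i j : 'I_n) : (i < alpha)%N -> (j < beta)%N -> A i j = 0.
    move=> ia jb; move/fintype.forallP/(_ i)/fintype.forallP/(_ j): block.
    by rewrite ia jb => /eqP.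
  have := Mind (fun ij => [set A ij.1 ij.2]%SET) (subxx (free_entries n alpha beta)).
  rewrite (_ : [set w | _] = [set w | M w = A]); last first.
    apply/seteqP; split => w /= H; last by move=> ij _; rewrite H inE.
    apply/matrixP => i j; have := H (i, j); rewrite !inE /=.
    have [/andP[ia jb] _|_ /(_ isT) /eqP //] := boolP ((i < alpha)%N && (j < beta)%N).
    by rewrite M0 // block.
  move=> ->; rewrite (big_morph EFin EFinM erefl) [RHS](bigID (mem (free_entries n alpha beta))) /=.
  rewrite [X in (_ * X)%E]big1 ?mule1 => [|[i j]]; last first.
    rewrite !inE negbK /= => /andP[ia jb]; rewrite block // -entry_lawE.
    rewrite -(probability_setT P); congr (P _); apply/seteqP; split => w //= _.
    exact: M0.
  apply: eq_bigr => ij _; rewrite -entry_lawE; congr (P _).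
  by apply/seteqP; split => w /=; rewrite inE => /eqP.
rewrite fintype.negb_forall => /fintype.existsP[i1].
rewrite fintype.negb_forall => /fintype.existsP[j1].
rewrite negb_imply => /andP[/andP[ia jb] Aij].
have E0 : [set w | M w i1 j1 = A i1 j1] = set0.
  by apply/seteqP; split => w //= Mw; rewrite -Mw M0 ?eqxx in Aij.
rewrite (_ : [set w | M w = A] = set0) ?measure0; last first.
  by apply/seteqP; split => w //= Mw; move: E0 => /seteqP[/(_ w) + _]; rewrite /= Mw; apply.
rewrite (bigD1 (i1, j1)) //= [X in X * _](_ : _ = 0) ?mul0r //.
by apply: EFin_inj; rewrite -entry_lawE E0 measure0.
Qed.

End MatrixLaw.
End FiniteProbability.
(** * Surjections *)

Section Surjections.
Variables (a n : nat) (G : finZmodType).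
Hypothesis expG : (exponent [set: G]%SET %| (Zp_trunc a).+2)%N.
Local Notation vec := 'cV['Z_a]_n.

Lemma SurP (A B : finZmodType) (F : {ffun A -> B}) :
  reflect ((forall x y, F (x + y) = F x + F y) /\ forall y, exists x, F x = y)
          (F \in Sur A B).
Proof.
rewrite inE; apply: (iffP andP) => [[/morphicP mF /eqP sF]|[mF sF]]; split.
- by move=> x y; apply: mF; rewrite inE.
- move=> y; have : y \in F @: [set: A]%SET by rewrite sF inE.
  by case/imsetP => x _ ->; exists x.
- by apply/morphicP => x y _ _; exact: mF.
- by apply/eqP/finset.setP => y; rewrite inE; have [x <-] := sF y; rewrite imset_f ?inE.
Qed.

Lemma additive_sum (A B : zmodType) (F : A -> B) :
  (forall x y, F (x + y) = F x + F y) ->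
  forall (I : finType) (u : I -> A) (k : I -> nat),
  F (\sum_i u i *+ k i) = \sum_i F (u i) *+ k i.
Proof.
move=> FD I u k.
have F0 : F 0 = 0 by apply: (addIr (F 0)); rewrite -FD !add0r.
rewrite (big_morph F FD F0); apply: eq_bigr => i _.
elim: (k i) => [|m IH]; first by rewrite !mulr0n.
by rewrite !mulrS FD IH.
Qed.

Definition unit_vec (i : 'I_n) : vec := delta_mx i 0.

Lemma vec_sum (x : vec) : x = \sum_i unit_vec i *+ x i 0.
Proof.
rewrite {1}[x]matrix_sum_delta; apply: eq_bigr => i _.
by rewrite big_ord1 -[x i 0 in LHS]natr_Zp scaler_nat.
Qed.

Definition vec_hom (f : {ffun 'I_n -> G}) : {ffun vec -> G} :=
  [ffun x : vec => \sum_i f i *+ x i 0].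

Lemma exponent_mulrn (g : G) : g *+ (Zp_trunc a).+2 = 0.
Proof. by rewrite -FinRing.zmodXgE (exponentP expG) ?inE. Qed.

(** Coordinates act through their representatives in [nat]; reduction modulo [a] drops a multiple of
    a number that kills [G]. *)
Lemma vec_homD f x y : vec_hom f (x + y) = vec_hom f x + vec_hom f y.
Proof.
rewrite !ffunE -big_split /=; apply: eq_bigr => i _; rewrite mxE -mulrnDr.
set N := (Zp_trunc a).+2; rewrite [in RHS](divn_eq (x i 0 + y i 0) N).
by rewrite mulrnDr mulnC mulrnA exponent_mulrn mul0rn add0r.
Qed.

Lemma vec_hom_unit f i : vec_hom f (unit_vec i) = f i.
Proof.
rewrite ffunE (bigD1 i) //= big1 ?addr0 => [|j ji].
  by rewrite mxE !eqxx.
by rewrite mxE (negPf ji).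
Qed.

Lemma vec_homK (F : {ffun vec -> G}) : (forall x y, F (x + y) = F x + F y) ->
  vec_hom [ffun i => F (unit_vec i)] = F.
Proof.
move=> FD; apply/ffunP => x; rewrite ffunE [in RHS](vec_sum x) (additive_sum FD).
by apply: eq_bigr => i _; rewrite ffunE.
Qed.

Lemma sum_Sur (V : nmodType) (Phi : {ffun vec -> G} -> V) :
  \sum_(F in Sur vec G) Phi F =
  \sum_(f : {ffun 'I_n -> G} | vec_hom f \in Sur vec G) Phi (vec_hom f).
Proof.
rewrite (reindex_onto vec_hom (fun F => [ffun i => F (unit_vec i)])) /=.
  apply: eq_bigl => f; rewrite [X in _ && X](_ : _ = true) ?andbT //.
  by apply/eqP/ffunP => i; rewrite ffunE vec_hom_unit.
by move=> F /SurP[FD _]; exact: vec_homK.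
Qed.

Lemma vec_hom_kills f (A : 'M['Z_a]_n) :
  [forall x : vec, vec_hom f (A *m x) == 0] =
  [forall j, \sum_i f i *+ A i j == 0].
Proof.
have colE j : vec_hom f (A *m unit_vec j) = \sum_i f i *+ A i j.
  by rewrite -colE ffunE; apply: eq_bigr => i _; rewrite mxE.
apply/fintype.forallP/fintype.forallP => [H j|H x]; first by rewrite -colE.
have AD x1 y1 : vec_hom f (A *m (x1 + y1)) = vec_hom f (A *m x1) + vec_hom f (A *m y1).
  by rewrite mulmxDr vec_homD.
rewrite [x]vec_sum (additive_sum AD) big1 // => j _.
by rewrite colE (eqP (H j)) mul0rn.
Qed.

Lemma Sur_detected f : vec_hom f \in Sur vec G -> detected (characters a G) f.
Proof.
move=> /SurP[_ fS]; apply/fintype.forallP => C; apply/implyP => CP; apply/implyP.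
apply: contraR; rewrite -eqn0Ngt cards_eq0 => /eqP/finset.setP w0.
apply/eqP/ffunP => g; have [x <-] := fS g; rewrite !ffunE characters_sum // big1 // => i _.
by have := w0 i; rewrite !inE /= => /negbFE/eqP Cf; rewrite charactersMn // Cf mul0rn.
Qed.

Lemma vec_hom_group_set f : group_set (vec_hom f @: [set: vec])%SET.
Proof.
apply/group_setP; split.
  by apply/imsetP; exists 0 => //; rewrite ffunE big1 // => i _; rewrite mxE.
move=> _ _ /imsetP[x _ ->] /imsetP[y _ ->].
by apply/imsetP; exists (x + y); rewrite ?inE ?vec_homD.
Qed.

Lemma leq_exp2 (m1 m2 k : nat) : (m1 <= m2)%N -> (m1 ^ k <= m2 ^ k)%N.
Proof. by move=> le12; case: k => // k; rewrite leq_exp2r. Qed.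

(* A map that is not onto takes its values in a proper subgroup, which has at
   most half of the elements. *)
Lemma card_nonSur :
  (#|[set f : {ffun 'I_n -> G} | vec_hom f \notin Sur vec G]%SET| <=
   2 ^ #|G| * (#|G| %/ 2) ^ n)%N.
Proof.
pose small := [set H : {set G} | (2 * #|H| <= #|G|)%N]%SET.
rewrite -sum1_card; under eq_bigl do rewrite inE.
(* A union bound over all small subsets, subgroups or not, which gives the crude factor
   [2 ^ #|G|]. *)
apply: (@leq_trans (\sum_(f : {ffun 'I_n -> G}) \sum_(H in small) (f \in ffun_on (mem H)))).
  rewrite big_mkcond /=; apply: leq_sum => f _; case: ifPn => // fS.
  pose H := Group (vec_hom_group_set f).
  have Hsmall : (H : {set G}) \in small.
    have : (#|H| %| #|[set: G]%G|)%N by rewrite cardSg ?finset.subsetT.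
    rewrite inE cardsT => /dvdnP[k kE].
    (* The index [k] is not 0, as [G] is nonempty, and not 1, as the map is not onto. *)
    rewrite kE leq_mul2r; apply/orP; right; case: k kE => [|[|//]] kE.
      by have : (0 < #|G|)%N; [apply/card_gt0P; exists 0 | rewrite kE].
    case/negP: fS; apply/SurP; split=> [x y|y]; first exact: vec_homD.
    have /eqP HT : (H : {set G}) == [set: G]%SET.
      by rewrite eqEcard finset.subsetT cardsT kE mul1n leqnn.
    have : y \in (H : {set G}) by rewrite HT inE.
    by case/imsetP => x _ ->; exists x.
  rewrite (bigD1 (H : {set G})) //= (_ : f \in ffun_on _) //.
  apply/ffun_onP => i; rewrite -(vec_hom_unit f i); exact: imset_f.
rewrite exchange_big /=.
apply: (@leq_trans (\sum_(H in small) (#|G| %/ 2) ^ n)).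
  apply: leq_sum => H; rewrite inE => Hs.
  rewrite -big_mkcond /= sum1_card card_ffun_on card_ord; apply: leq_exp2.
  by rewrite leq_divRL // mulnC.
rewrite sum_nat_const; apply: leq_mul => //.
by rewrite -cardsT -card_powerset; apply/subset_leq_card/fintype.subsetP => H _; rewrite powersetE finset.subsetT.
Qed.

End Surjections.

Section SurQuotient.
Variables (a n : nat) (G : finZmodType).
Local Notation vec := 'cV['Z_a]_n.

(** Universal property of the quotient: composition with the projection is injective, and its image
    consists of the surjections that kill the column span. *)
Lemma card_Sur_cok (A : 'M['Z_a]_n) :
  #|Sur (cok A) G| =
  #|[set F in Sur vec G | [forall x : vec, F (A *m x) == 0]]%SET|.
Proof.
have abV : abelian [set: vec]%G by exact: FinRing.zmod_abelian.
have nA (x : vec) : x \in ('N(colspan A))%g.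
  have sN : [set: vec]%SET \subset 'N(colspan A)%g.
    by apply: cents_norm; apply: (fintype.subset_trans abV); apply: centS; exact: finset.subsetT.
  by apply: (fintype.subsetP sN); rewrite inE.
pose cs (x : vec) : cok A := coset (colspan A) x.
have csD x y : cs (x + y) = (cs x * cs y)%g by exact: (morphM (coset_morphism _)).
have cs_repr (u : cok A) : cs (repr u) = u by exact: coset_reprK.
pose lift (h : {ffun cok A -> G}) : {ffun vec -> G} := [ffun x => h (cs x)].
have lift_inj : injective lift.
  move=> h1 h2 /ffunP E; apply/ffunP => u.
  by have := E (repr u); rewrite !ffunE cs_repr.
rewrite -(card_imset _ lift_inj); apply: eq_card => F.
apply/imsetP/idP => [[h + ->]|].
  rewrite inE => /andP[/morphicP mh /eqP sh].
  have hM u v : h (u * v)%g = h u + h v by apply: mh; rewrite inE.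
  have h1 : h 1%g = 0 by apply: (addIr (h 1%g)); rewrite -hM mulg1 add0r.
  rewrite inE; apply/andP; split.
    apply/SurP; split=> [x y|y]; first by rewrite !ffunE csD hM.
    have : y \in h @: [set: cok A]%SET by rewrite sh inE.
    by case/imsetP => u _ ->; exists (repr u); rewrite ffunE cs_repr.
  apply/fintype.forallP => x; rewrite ffunE (_ : cs (A *m x) = 1%g) ?h1 //.
  by apply: coset_id; apply/imsetP; exists x.
rewrite inE => /andP[/SurP[FD Fs] /fintype.forallP FA].
pose h : {ffun cok A -> G} := [ffun u : cok A => F (repr u)].
have hcs x : h (cs x) = F x.
  (* The chosen representative differs from [x] by an element of the column span, which [F]
     kills. *)
  rewrite ffunE; have : repr (cs x) \in (colspan A :* x)%g.
    by rewrite -val_coset //; exact: mem_repr_coset.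
  case/rcosetP => _ /imsetP[y _ ->] ->.
  by rewrite [LHS]FD (eqP (FA y)) add0r.
exists h; last by apply/ffunP => x; rewrite ffunE hcs.
rewrite inE; apply/andP; split.
  apply/morphicP => u v _ _.
  by rewrite -[u]cs_repr -[v]cs_repr -csD !hcs FD.
apply/eqP/finset.setP => y; rewrite inE; have [x <-] := Fs y.
by rewrite -hcs imset_f ?inE.
Qed.

End SurQuotient.

(** Telescoping with [x v - 1 = (x - 1) + x (v - 1)]; this combines the column deviations into one
    for the matrix. *)
Lemma prodrB1_norm_le (R : realType) (I : finType) (x y : I -> R) :
  (forall i, `|x i - 1| <= y i - 1) -> `|\prod_i x i - 1| <= \prod_i y i - 1.
Proof.
move=> xy.
suff : `|\prod_i x i - 1| <= \prod_i y i - 1 /\ 1 <= \prod_i y i by case.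
have y1 i : 1 <= y i by rewrite -subr_ge0; apply: le_trans (xy i).
elim/big_rec2 : _ => [|i u v _ [uv v1]]; first by rewrite !subrr normr0.
split; last by rewrite -[leLHS]mulr1 ler_pM.
have -> : x i * v - 1 = (x i - 1) + x i * (v - 1).
  by rewrite mulrBr mulr1 [RHS]addrC addrA subrK.
have xy' : `|x i| <= y i.
  have -> : x i = (x i - 1) + 1 by rewrite subrK.
  by apply: le_trans (ler_normD _ _) _; rewrite normr1 -lerBrDr.
apply: le_trans (ler_normD _ _) _; rewrite normrM.
have -> : y i * u - 1 = (y i - 1) + y i * (u - 1).
  by rewrite mulrBr mulr1 [RHS]addrC addrA subrK.
by apply: lerD => //; apply: ler_pM.
Qed.

(** The product law factors over columns, and the event asks that each column be killed. In the
    first [beta] columns only the rows from [alpha] on are free. *)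
Lemma kill_probability_bound (a n alpha beta : nat) (G : finZmodType) (R : realType)
    (z : (R[i])%C) (rho : R) (w : 'I_n -> 'I_n -> 'Z_a -> R) (f : {ffun 'I_n -> G}) :
  (Zp_trunc a).+2.-primitive_root z ->
  (exponent [set: G]%SET %| (Zp_trunc a).+2)%N ->
  (alpha <= n)%N -> (beta <= n)%N -> 0 <= rho <= 1 ->
  (forall i j x, 0 <= w i j x) -> (forall i j, \sum_x w i j x = 1) ->
  (forall i j c, (i, j) \in free_entries n alpha beta -> c != 0 ->
     `|charfun z (w i j) c| <= real_complex R rho) ->
  `| #|G|%:R ^+ n * (\sum_(A : 'M['Z_a]_n | [forall j, \sum_i f i *+ A i j == 0])
        \prod_i \prod_j w i j (A i j)) - 1| <=
  mass rho (characters a G) [set: 'I_n]%SET f ^+ (n - beta) *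
  mass rho (characters a G) [set i : 'I_n | (alpha <= i)%N]%SET f ^+ beta - 1.
Proof.
move=> zP expG an bn rho01 w0 w1 wfree.
pose col j := \sum_(v : {ffun 'I_n -> 'Z_a} | \sum_i f i *+ v i == 0) \prod_i w i j (v i).
have -> : \sum_(A : 'M['Z_a]_n | [forall j, \sum_i f i *+ A i j == 0])
    \prod_i \prod_j w i j (A i j) = \prod_j col j.
  rewrite /col; under [RHS]eq_bigr do rewrite big_mkcond /=.
  rewrite bigA_distr_bigA /=.
  rewrite (reindex (fun h : {ffun 'I_n -> {ffun 'I_n -> 'Z_a}} => \matrix_(i, j) h j i)) /=;
    last first.
    exists (fun A : 'M['Z_a]_n => [ffun j => [ffun i => A i j]]) => [h _|A _].
      by apply/ffunP => j; apply/ffunP => i; rewrite !ffunE mxE.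
    by apply/matrixP => i j; rewrite mxE !ffunE.
  rewrite big_mkcond /=; apply: eq_bigr => h _.
  under eq_forallb do under eq_bigr do rewrite mxE.
  rewrite exchange_big /=; case: ifPn => [/fintype.forallP H|].
    by apply: eq_bigr => j _; rewrite H; apply: eq_bigr => i _; rewrite mxE.
  by rewrite fintype.negb_forall => /fintype.existsP[j Hj]; rewrite (bigD1 j) //= (negPf Hj) mul0r.
pose J (j : 'I_n) := if (j < beta)%N then [set i : 'I_n | (alpha <= i)%N]%SET else [set: 'I_n]%SET.
have -> : #|G|%:R ^+ n * \prod_j col j = \prod_j (#|G|%:R * col j).
  by rewrite big_split /= prodr_const card_ord.
have cb : #|[set j : 'I_n | (j < beta)%N]%SET| = beta.
  have := cardsC [set j : 'I_n | (beta <= j)%N]%SET.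
  rewrite card_rows // card_ord (_ : ~: _ = [set j : 'I_n | (j < beta)%N]%SET).
    by move: bn; clear; lia.
  by apply/finset.setP => j; rewrite !inE ltnNge.
have -> : mass rho (characters a G) [set: 'I_n]%SET f ^+ (n - beta) *
  mass rho (characters a G) [set i : 'I_n | (alpha <= i)%N]%SET f ^+ beta =
  \prod_j mass rho (characters a G) (J j) f.
  rewrite (bigID (fun j : 'I_n => (j < beta)%N)) /= mulrC; congr (_ * _).
    rewrite -[in LHS]cb cardsE -prodr_const; apply: eq_big => // j jb.
    by rewrite /J (jb : (j < beta)%N).
  rewrite -(card_rows bn) cardsE -prodr_const; apply: eq_big => j.
    by rewrite -leqNgt.
  by move=> jb; rewrite /J ltnNge (jb : (beta <= j)%N).
apply: prodrB1_norm_le => j; apply: (@column_bound a R z zP G expG _ (J j) rho (fun i => w i j) f) => // i c iJ c0.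
apply: wfree => //; rewrite inE /=; move: iJ; rewrite /J.
by case: ifP => jb; rewrite ?inE ?andbF // andbT -leqNgt.
Qed.
(** * Limits *)

(** The proportion of tuples that do not generate is at most [2 ^ #|G| / 2 ^ n]. *)
Lemma Sur_count_limit (a : nat) (G : finZmodType) (R : realType) (d : R) :
  (exponent [set: G]%SET %| (Zp_trunc a).+2)%N -> 0 < d ->
  exists m0, forall n, (m0 <= n)%N ->
  (1 - d) * #|G|%:R ^+ n <=
  #|[set f : {ffun 'I_n -> G} | vec_hom a f \in Sur 'cV['Z_a]_n G]%SET|%:R.
Proof.
move=> expG d0.
have [m0 Hm0] : exists m0, forall m, (m0 <= m)%N ->
    (1 / 2%:R) ^+ m <= d / 2%:R ^+ #|G| :> R.
  apply: expr_small; last by rewrite divr_gt0 // exprn_gt0.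
  by apply/andP; split; [rewrite divr_ge0 | rewrite ltr_pdivrMr // mul1r ltr1n].
exists m0 => n mn.
set S := [set f | _]%SET.
have cS : #|S|%:R = #|G|%:R ^+ n - #|~: S|%:R :> R.
  have cSC : (#|S| + #|~: S| = #|G| ^ n)%N by rewrite cardsC card_ffun card_ord.
  by rewrite -natrX -cSC natrD addrK.
rewrite cS mulrBl mul1r lerD2l lerN2.
have -> : ~: S = [set f : {ffun 'I_n -> G} | vec_hom a f \notin Sur 'cV['Z_a]_n G]%SET.
  by apply/finset.setP => f; rewrite !inE.
apply: (@le_trans _ _ ((2 ^ #|G| * (#|G| %/ 2) ^ n)%:R)); first by rewrite ler_nat card_nonSur.
rewrite natrM !natrX.
apply: (@le_trans _ _ (2%:R ^+ #|G| * ((1 / 2%:R) ^+ n * #|G|%:R ^+ n))).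
  apply: ler_wpM2l; first by rewrite exprn_ge0.
  rewrite -exprMn; apply: lerXn2r; rewrite ?nnegrE ?mulr_ge0 ?divr_ge0 //.
  by rewrite mul1r mulrC ler_pdivlMr // -natrM ler_nat leq_divM.
rewrite mulrA; apply: ler_wpM2r; first by rewrite exprn_ge0.
by rewrite mulrC -ler_pdivlMr ?exprn_gt0 // Hm0.
Qed.

(* In the Fourier expansions summed over the surjections, the trivial characters
   give #|Sur| / #|G|^n, and the count bounds the absolute value of the rest. *)
Lemma moment_limit (a : nat) (G : finZmodType) (R : realType) (eps : R)
    (alpha beta : nat -> nat) (w : forall n, 'I_n -> 'I_n -> 'Z_a -> R) :
  (exponent [set: G]%SET %| (Zp_trunc a).+2)%N -> 0 < eps < 1 ->
  (forall n i j x, 0 <= w n i j x) -> (forall n i j, \sum_x w n i j x = 1) ->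
  (forall n i j (c r : 'Z_a), (i, j) \in free_entries n (alpha n) (beta n) ->
     c != 0 -> \sum_(x | c * (x - r) == 0) w n i j x <= 1 - eps) ->
  (forall m0, exists n0, forall n, (n0 <= n)%N -> (alpha n + beta n + m0 <= n)%N) ->
  forall d : R, 0 < d -> exists n0, forall n, (n0 <= n)%N ->
  `| \sum_(f : {ffun 'I_n -> G} | vec_hom a f \in Sur 'cV['Z_a]_n G)
       \sum_(A : 'M['Z_a]_n | [forall j, \sum_i f i *+ A i j == 0])
          \prod_i \prod_j w n i j (A i j) - 1| <= d.
Proof.
move=> expG eps01 w0 w1 wbal ab d d0.
have [z zP] := @closed_prim_root_exists (R[i])%C (Zp_trunc a).+2 isT.
have [rho rho01 Hrho] := charfun_contract zP eps01.
have rho01' : 0 <= rho <= 1 by case/andP: rho01 => -> /ltW.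
have d3 : 0 < d / 3%:R by rewrite divr_gt0.
have [m1 Hm1] := weighted_count_limit rho01 (subxx _)
  (characters_zmod_closed a G) d3.
have [m2 Hm2] := Sur_count_limit expG d3.
have [n0 Hn0] := ab (m1 + m2)%N.
exists n0 => n nn; have {}Hn0 := Hn0 n nn.
have an : (alpha n <= n)%N by move: Hn0; clear; lia.
have bn : (beta n <= n)%N by move: Hn0; clear; lia.
have {}Hm1 := Hm1 n (alpha n) (beta n) (_ : (alpha n + beta n + m1 <= n)%N).
have {}Hm1 := Hm1 (ltac:(move: Hn0; clear; lia)).
have {}Hm2 := Hm2 n (ltac:(move: Hn0; clear; lia)).
pose p (f : {ffun 'I_n -> G}) :=
  \sum_(A : 'M['Z_a]_n | [forall j, \sum_i f i *+ A i j == 0])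
          \prod_i \prod_j w n i j (A i j).
pose Y (f : {ffun 'I_n -> G}) :=
  mass rho (characters a G) [set: 'I_n]%SET f ^+ (n - beta n) *
  mass rho (characters a G) [set i : 'I_n | (alpha n <= i)%N]%SET f ^+ beta n.
pose S := [set f : {ffun 'I_n -> G} | vec_hom a f \in Sur 'cV['Z_a]_n G]%SET.
have bound f : `|#|G|%:R ^+ n * p f - 1| <= Y f - 1.
  apply: (@kill_probability_bound a n (alpha n) (beta n) G R z rho (w n) f
    zP expG an bn rho01' (w0 n) (w1 n)) => i j c ij c0.
  by apply: Hrho => // r; exact: wbal.
have Y0 f : 0 <= Y f.
  by rewrite -[Y f](subrK 1) addr_ge0 //; apply: le_trans (bound f).
(* Since [Y] is nonnegative, the sum may be extended from surjective to detected tuples. *)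
have sumY : \sum_(f in S) Y f <= (1 + d / 3%:R) * #|G|%:R ^+ n.
  apply: le_trans Hm1; rewrite /weighted_count [leRHS](bigID (mem S)) /=.
  rewrite -[leLHS]addr0; apply: lerD; last first.
    by apply: sumr_ge0 => f _; apply: mulr_ge0 => //; exact: Y0.
  by apply: ler_sum => f; rewrite inE => /Sur_detected ->; rewrite mul1r.
have gn0 : 0 < #|G|%:R ^+ n :> R.
  by rewrite exprn_gt0 // ltr0n; apply/card_gt0P; exists 0.
set T := \sum_(f | _) _.
have TE : T = \sum_(f in S) p f by apply: eq_bigl => f; rewrite [in RHS]finset.in_set.
have Tb : `|#|G|%:R ^+ n * T - #|S|%:R| <= \sum_(f in S) Y f - #|S|%:R.
  have cS : #|S|%:R = \sum_(f in S) (1 : R) by rewrite sumr_const.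
  rewrite TE cS mulr_sumr -!sumrB; apply: le_trans (ler_norm_sum _ _ _) _.
  by apply: ler_sum => f _; exact: bound.
have Sle : #|S|%:R <= #|G|%:R ^+ n :> R.
  rewrite -natrX ler_nat; apply: leq_trans (max_card _) _.
  by rewrite card_ffun card_ord.
rewrite -(ler_pM2l gn0) -[X in X * `|_|](ger0_norm (ltW gn0)) -normrM mulrBr mulr1.
(* One third of [d] is spent on the sum of [Y], and one on each of the two occurrences of [#|S|]. *)
apply: (@le_trans _ _ ((\sum_(f in S) Y f - #|S|%:R) + (#|G|%:R ^+ n - #|S|%:R))).
  rewrite -[X in `|X|](subrKA #|S|%:R); apply: le_trans (ler_normD _ _) _.
  by rewrite lerD // distrC ger0_norm // subr_ge0.
move: sumY Hm2; rewrite -/S; set g := #|G|%:R ^+ n; set s := #|S|%:R.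
set y := \sum_(f in S) Y f.
have -> : g * d = 3%:R * (d / 3%:R * g) by field.
rewrite mulrDl mulrBl mul1r; set e := d / 3%:R * g; clear; lra.
Qed.
Theorem theorem8p1 (R : realType) (a : nat) (eps : R)
    (alpha beta : nat -> nat)
    (d : nat -> measure_display)
    (Omega : forall n : nat, measurableType (d n))
    (P : forall n : nat, probability (Omega n) R)
    (M : forall n : nat, Omega n -> 'M['Z_a]_n) :
  (2 <= a)%N ->
  0 < eps < 1 ->
  (forall n : nat, (1 <= n)%N ->
     (1 <= alpha n <= n)%N /\ (1 <= beta n <= n)%N) ->
  (forall (n : nat) (i j : 'I_n),
     fin_random_variable (fun w : Omega n => M n w i j)) ->
  (forall (n : nat) (i j : 'I_n), (i < alpha n)%N -> (j < beta n)%N ->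
     forall w : Omega n, M n w i j = 0) ->
  (forall n : nat,
     independent_on (P n) (free_entries n (alpha n) (beta n))
       (fun (ij : 'I_n * 'I_n) (w : Omega n) => M n w ij.1 ij.2)) ->
  (forall (n : nat) (ij : 'I_n * 'I_n),
     ij \in free_entries n (alpha n) (beta n) ->
     balanced (P n) eps (fun w : Omega n => M n w ij.1 ij.2)) ->
  ((n%:R - (alpha n)%:R - (beta n)%:R : R) @[n --> \oo] --> +oo) ->
  forall G : finZmodType, (exponent [set: G]%SET %| a)%N ->
  (('E_(P n)[fun w : Omega n => #|Sur (cok (M n w)) G|%:R])%E @[n --> \oo]
     --> 1%E) /\
  ((\sum_(F in Sur 'cV['Z_a]_n G)
      P n [set w : Omega n |
             forall x : 'cV['Z_a]_n, F (M n w *m x)%R = 0%R])%E @[n --> \oo]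
     --> 1%E).
Proof.
move=> a2 eps01 _ mM M0 Mind Mbal ab G; rewrite -{1}(Zp_cast a2) => expG.
have mMat n : fin_random_variable (M n) by exact: fin_random_matrix (mM n).
pose kills n (F : {ffun 'cV['Z_a]_n -> G}) : pred 'M['Z_a]_n :=
  fun A => [forall x : 'cV['Z_a]_n, F (A *m x) == 0].
have killsE n (F : {ffun 'cV['Z_a]_n -> G}) :
    [set w : Omega n | forall x : 'cV['Z_a]_n, F (M n w *m x) = 0] =
    [set w | kills n F (M n w)].
  apply/seteqP; split => w /= H; first by apply/fintype.forallP => x; apply/eqP.
  by move=> x; apply/eqP; move/fintype.forallP: H.
have EE n : ('E_(P n)[fun w : Omega n => #|Sur (cok (M n w)) G|%:R] =
    \sum_(F in Sur 'cV['Z_a]_n G) P n [set w | kills n F (M n w)])%E.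
  rewrite -(expectation_card (P n) (Sur 'cV['Z_a]_n G) (kills n)) //.
  by congr expectation; apply/funext => w; rewrite card_Sur_cok.
pose w n := @entry_law _ _ R (P n) a n (M n).
pose T n : R := \sum_(f : {ffun 'I_n -> G} | vec_hom a f \in Sur 'cV['Z_a]_n G)
   \sum_(A : 'M['Z_a]_n | [forall j, \sum_i f i *+ A i j == 0])
      \prod_i \prod_j w n i j (A i j).
have TE n : (\sum_(F in Sur 'cV['Z_a]_n G) P n [set w | kills n F (M n w)])%E = (T n)%:E.
  rewrite sum_Sur /T -sumEFin; apply: eq_bigr => f _.
  have [_ ->] := fin_law (P n) (kills n (vec_hom a f)) (mMat n).
  rewrite -sumEFin; apply: eq_big => A; first by rewrite /kills (vec_hom_kills expG).
  by move=> _; apply: (matrix_law (mM n) (M0 n) (Mind n)).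
rewrite (_ : (fun n => 'E_(P n)[_])%E = EFin \o T); last first.
  by apply/funext => n; rewrite EE TE.
rewrite (_ : (fun n => \sum_(F in _) _)%E = EFin \o T); last first.
  by apply/funext => n; rewrite /= -TE; apply: eq_bigr => F _; rewrite killsE.
(* Both sequences are now the same real sequence [T]. *)
suff H : (EFin \o T) n @[n --> \oo] --> 1%E by split.
apply/neq0_fine_cvgP; first exact: oner_neq0.
apply/cvgrPdist_le => e e0.
have w0 n i j x : 0 <= w n i j x by exact: entry_law_ge0.
have w1 n i j : \sum_x w n i j x = 1 by apply: entry_law_sum1; exact: mM.
have wbal n i j (c r : 'Z_a) : (i, j) \in free_entries n (alpha n) (beta n) ->
    c != 0 -> \sum_(x | c * (x - r) == 0) w n i j x <= 1 - eps.
  by move=> ij c0; apply: (entry_law_balanced (mM n) (Mbal n)).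
(* The divergence concerns differences of reals, so it gives an inequality in [nat] free of
   truncated subtraction. *)
have gap m0 : exists n0, forall n, (n0 <= n)%N -> (alpha n + beta n + m0 <= n)%N.
  move/cvgryPge: ab => /(_ m0%:R)[n0 _ Hn0]; exists n0 => n nn.
  by have := Hn0 n nn; rewrite /= -(ler_nat R) !natrD; lra.
have [n0 Hn0] := moment_limit expG eps01 w0 w1 wbal gap e0.
by exists n0 => // n nn; rewrite /= distrC; exact: Hn0.
Qed.
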